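(* There exist absolute constants $0<c<C$ such that the following holds. Let $\mathbb{F}=\mathbb{F}(n)$ be any field and let $p=p(n)$ satisfy $n^{-1}\le p\le 1-n^{-0.99}$. Then with probability tending to $1$ as $n\to\infty$, $$c\,\frac{n\log(1/p)}{\log n}\ \le\ \operatorname{minrank}_{\mathbb{F}}(G(n,p))\ \le\ C\,\frac{n\log(1/p)}{\log n}.$$
   Context: For a graph $G$ on vertex set $[n]$ and a field $\mathbb{F}$, $\operatorname{minrank}_{\mathbb{F}}(G)$ is the minimum rank of a matrix $M\in\mathbb{F}^{n\times n}$ with all diagonal entries nonzero such that $M_{i,j}=0$ whenever $i\neq j$ and $i,j$ are nonadjacent in $G$. $G(n,p)$ denotes the binomial random graph on $[n]$ in which each pair is an edge independently with probability $p$. *)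

(* Defs.v *)
From HB Require Import structures.
From mathcomp Require Import all_boot all_order all_algebra.
From Stdlib Require Import Reals ClassicalEpsilon.
Set Implicit Arguments. Unset Strict Implicit. Unset Printing Implicit Defensive.

(* Vertex set [n] = 'I_n.  A graph on [n] is a set of unordered pairs,
   encoded as a subset of upairs n = {(i,j) | i < j}. *)
Definition upairs (n : nat) : {set 'I_n * 'I_n} :=
  [set x : 'I_n * 'I_n | (x.1 < x.2)%N].

Definition graphs (n : nat) : seq {set 'I_n * 'I_n} :=
  enum (powerset (upairs n)).

Definition adj (n : nat) (E : {set 'I_n * 'I_n}) (i j : 'I_n) : bool :=
  ((i, j) \in E) || ((j, i) \in E).

Definition fits (F : fieldType) (n : nat) (E : {set 'I_n * 'I_n})
    (M : 'M[F]_n) : Prop :=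
  (forall i, M i i != (GRing.zero : F)) /\
  (forall i j, i != j -> ~~ adj E i j -> M i j = (GRing.zero : F)).

Definition minrank_pred (F : fieldType) (n : nat) (E : {set 'I_n * 'I_n})
    (k : nat) : bool :=
  if excluded_middle_informative
       (exists M : 'M[F]_n, fits E M /\ (\rank M <= k)%N)
  then true else false.

Lemma minrank_ex (F : fieldType) (n : nat) (E : {set 'I_n * 'I_n}) :
  exists k, minrank_pred F E k.
Proof.
exists n; rewrite /minrank_pred.
case: excluded_middle_informative => // H; exfalso; apply: H.
exists (scalar_mx (GRing.one F) : 'M[F]_n); split; last exact: rank_leq_row.
split.
- by move=> i; rewrite mxE eqxx /=; exact: GRing.oner_neq0.
- by move=> i j Hij _; rewrite mxE (negbTE Hij).
Qed.

Definition minrank (F : fieldType) (n : nat) (E : {set 'I_n * 'I_n}) : nat :=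
  ex_minn (minrank_ex F E).

Local Open Scope R_scope.

Definition gnp_weight (n : nat) (p : R) (E : {set 'I_n * 'I_n}) : R :=
  p ^ #|E| * (1 - p) ^ (#|upairs n| - #|E|).

Definition gnp_prob (n : nat) (p : R) (A : {set 'I_n * 'I_n} -> Prop) : R :=
  List.fold_right Rplus 0
    (List.map (fun E => gnp_weight p E *
                 (if excluded_middle_informative (A E) then 1 else 0))
              (graphs n)).

(* Main.v *)
Require Import Defs.
From HB Require Import structures.
From mathcomp Require Import all_boot all_order perm all_algebra zify.
From Stdlib Require Import Reals Lra ClassicalEpsilon.
Set Implicit Arguments. Unset Strict Implicit. Unset Printing Implicit Defensive.

(** Lower bound.  Among the principal submatrices of a matrix fitting the graph
    choose one, of size m, rank k and with s nonzero entries, minimizing k/m.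
    By minimality, greedily chosen row and column bases have at most s k/m nonzero
    entries each, and these entries determine the submatrix, so that it has at
    most n^(O(s k/m)) zero-patterns (Ronyai-Babai-Ganapathy).  Its columns being
    nonzero, s >= m^2/k.  A given pattern fits G(n,p) with probability at most
    p^((s-m)/2), which beats the number of patterns if k/m is at most a small
    multiple of log(1/p)/log n.

    Upper bound.  If p is at most a small negative power of n, the trivial bound n
    suffices.  Otherwise minrank is at most the number of parts of a cover by
    cliques: put l = floor(log n / (1000 log(1/p))) and insert the vertices one by
    one into about 2n/l cliques of capacity l.  At least half of the cliques are
    never full, so a vertex fits into none of them with probability at most
    (1-p^l)^(n/l) <= n^(-2). *)

Delimit Scope nat_scope with N.
Local Notation "m ^ n" := (expn m n) : nat_scope.

(** * Zero-patterns of polynomials *)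

Section ZeroPatterns.
Import GRing.Theory.
Local Open Scope ring_scope.
Variables (F : fieldType) (N : nat).
Implicit Types (g h : ('I_N -> F) -> F) (d e : nat).

Definition monomial (q : {ffun 'I_N -> nat}) (u : 'I_N -> F) : F :=
  \prod_t u t ^+ q t.

(** The degree is bounded in each variable separately, so that the monomials number [d.+1 ^ N];
    polynomials matter only through their values. *)
Definition polyfun d g : Prop :=
  exists2 l : seq (F * {ffun 'I_N -> nat}),
    (forall q, q \in l -> forall t, (q.2 t <= d)%N)
    & forall u, g u = \sum_(q <- l) q.1 * monomial q.2 u.

Lemma polyfun_ext d g h : g =1 h -> polyfun d g -> polyfun d h.
Proof. by move=> gh [l ld gl]; exists l => // u; rewrite -gh. Qed.

Lemma polyfun_leq d e g : (d <= e)%N -> polyfun d g -> polyfun e g.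
Proof.
move=> de [l ld gl]; exists l => // q ql t; exact: leq_trans (ld q ql t) de.
Qed.

Lemma polyfun_const d (a : F) : polyfun d (fun=> a).
Proof.
exists [:: (a, [ffun=> 0%N])] => [q|u]; first by rewrite inE => /eqP-> t; rewrite ffunE.
by rewrite big_seq1 /monomial big1 ?mulr1 // => t _; rewrite ffunE.
Qed.

Lemma polyfun_var t : polyfun 1 (fun u => u t).
Proof.
exists [:: (1, [ffun s => (s == t) : nat])] => [q|u].
  by rewrite inE => /eqP-> s; rewrite ffunE leq_b1.
rewrite big_seq1 mul1r /monomial (bigD1 t) //= ffunE eqxx big1 ?mulr1 // => s st.
by rewrite ffunE (negbTE st).
Qed.

Lemma polyfunD d g h :
  polyfun d g -> polyfun d h -> polyfun d (fun u => g u + h u).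
Proof.
move=> [l ld gl] [l' ld' hl]; exists (l ++ l') => [q|u].
  by rewrite mem_cat => /orP[/ld|/ld'].
by rewrite big_cat gl hl.
Qed.

Lemma polyfunM d e g h :
  polyfun d g -> polyfun e h -> polyfun (d + e) (fun u => g u * h u).
Proof.
move=> [l ld gl] [l' ld' hl].
exists [seq (q.1 * r.1, [ffun t : 'I_N => (q.2 t + r.2 t)%N])
         | q : F * {ffun 'I_N -> nat} <- l, r : F * {ffun 'I_N -> nat} <- l'] => [q|u].
  by case/allpairsP=> -[q1 q2] /= [/ld l1 /ld' l2 ->] t; rewrite ffunE leq_add.
rewrite big_allpairs_dep gl hl big_distrl; apply: eq_bigr => q _.
rewrite big_distrr; apply: eq_bigr => r _ /=.
rewrite mulrACA; congr (_ * _).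
by rewrite /monomial -big_split; apply: eq_bigr => t _; rewrite ffunE exprD.
Qed.

Lemma polyfun_sum (I : Type) (r : seq I) (P : pred I) d
    (h : I -> ('I_N -> F) -> F) :
  (forall i, polyfun d (h i)) -> polyfun d (fun u => \sum_(i <- r | P i) h i u).
Proof.
move=> hd; elim: r => [|i r IH].
  by apply: polyfun_ext (polyfun_const d 0) => u; rewrite big_nil.
case Pi: (P i); last by apply: polyfun_ext IH => u; rewrite big_cons Pi.
by apply: polyfun_ext (polyfunD (hd i) IH) => u; rewrite big_cons Pi.
Qed.

Lemma polyfun_prod (I : finType) (P : pred I) d (h : I -> ('I_N -> F) -> F) :
  (forall i, polyfun d (h i)) ->
  polyfun (#|I| * d) (fun u => \prod_(i | P i) h i u).
Proof.
move=> hd; rewrite cardT.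
have: forall r : seq I, polyfun (size r * d) (fun u => \prod_(i <- r | P i) h i u).
  elim=> [|i r IH].
    by apply: polyfun_ext (polyfun_const _ 1) => u; rewrite big_nil.
  case Pi: (P i); last first.
    apply: polyfun_ext (polyfun_leq _ IH) => [u|]; first by rewrite big_cons Pi.
    by rewrite leq_mul2r leqnSn orbT.
  by apply: polyfun_ext (polyfunM (hd i) IH) => u; rewrite big_cons Pi.
move/(_ (enum I)); apply: polyfun_ext => u.
by rewrite big_enum_cond; apply: eq_bigl => i; rewrite inE.
Qed.

Lemma polyfun_coef D g : polyfun D g ->
  exists c : {ffun 'I_N -> 'I_D.+1} -> F,
    forall u, g u = \sum_m c m * \prod_t u t ^+ m t.
Proof.
case=> l lD gl.
pose tr (q : {ffun 'I_N -> nat}) : {ffun 'I_N -> 'I_D.+1} := [ffun t => inord (q t)].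
exists (fun m => \sum_(q <- l | tr q.2 == m) q.1) => u.
rewrite gl big_seq.
under [RHS]eq_bigr => m _ do rewrite big_distrl big_mkcond big_seq.
rewrite exchange_big; apply: eq_bigr => q ql /=.
rewrite -big_mkcond (big_pred1 (tr q.2)) => [|m]; last by rewrite eq_sym.
congr (_ * _); apply: eq_bigr => t _.
by rewrite ffunE inordK // ltnS lD.
Qed.

(* Ronyai-Babai-Ganapathy: the products [g S] of the functions indexed by a
   pattern [S] are independent, since [g S] is nonzero at a witness of [T] iff
   [S \subset T]. *)
Lemma zero_patterns (I : finType) (h : I -> ('I_N -> F) -> F) d
    (P : {set {set I}}) :
  (forall i, polyfun d (h i)) ->
  (forall S, S \in P -> exists u, S = [set i | h i u != 0]) ->
  (#|P| <= (#|I| * d).+1 ^ N)%N.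
Proof.
move=> hd hP; set D := (#|I| * d)%N.
pose g (S : {set I}) u := \prod_(i in S) h i u.
have [w hw] : exists w : {set I} -> 'I_N -> F,
    forall S, S \in P -> S = [set i | h i (w S) != 0].
  apply: (fin_all_exists (P := fun S u => S \in P -> S = [set i | h i u != 0])).
  move=> S; case SP: (S \in P); last by exists (fun=> 0).
  by have [u hu] := hP S SP; exists u.
have gw S T : T \in P -> (g S (w T) != 0) = (S \subset T).
  move=> TP; apply/prodf_neq0/subsetP => [hS i iS|hS i iS].
    by rewrite (hw T TP) inE hS.
  by have := hS i iS; rewrite {1}(hw T TP) inE.
have [c hc] : exists c : {set I} -> {ffun 'I_N -> 'I_D.+1} -> F,
    forall S u, g S u = \sum_m c S m * \prod_t u t ^+ m t.
  apply: (fin_all_exists (P := fun S (c : {ffun 'I_N -> 'I_D.+1} -> F) =>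
    forall u, g S u = \sum_m c m * \prod_t u t ^+ m t)) => S.
  by apply: polyfun_coef; exact: polyfun_prod.
(* The matrix of the values of [g S] at the witness of [T] factors through the monomials, so its
   rank is at most their number. *)
pose C := \matrix_(a < #|P|, m < #|{ffun 'I_N -> 'I_D.+1}|)
  c (enum_val a) (enum_val m).
pose V := \matrix_(m < #|{ffun 'I_N -> 'I_D.+1}|, b < #|P|)
  \prod_t w (enum_val b) t ^+ (enum_val m : {ffun 'I_N -> 'I_D.+1}) t.
have CV a b : (C *m V) a b = g (enum_val a) (w (enum_val b)).
  rewrite mxE hc [RHS](reindex_onto enum_val enum_rank) => [|m _];
    last exact: enum_rankK.
  rewrite [RHS](eq_bigl predT) => [|m]; last by rewrite enum_valK eqxx.
  by apply: eq_bigr => m _; rewrite !mxE.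
suff free : row_free (C *m V).
  have := mxrankM_maxl C V; rewrite (eqP free).
  move/leq_trans/(_ (rank_leq_col C)).
  by rewrite card_ffun !card_ord.
rewrite -kermx_eq0; apply/eqP/row_matrixP => i; rewrite row0.
set z := row i _.
have zCV : z *m (C *m V) = 0.
  by rewrite -row_mul mulmx_ker row0.
apply/rowP => a0; rewrite [RHS]mxE; apply/eqP/negPn/negP => za0.
(* Take a pattern of least cardinality in a linear dependency: it contains no other pattern of the
   dependency, so at its witness only its own term survives. *)
pose a := [arg min_(b < a0 | z 0 b != 0) #|(enum_val b : {set I})|].
have [za amin] : z 0 a != 0 /\
    forall b, z 0 b != 0 -> (#|(enum_val a : {set I})| <= #|(enum_val b : {set I})|)%N.
  by rewrite /a; case: arg_minnP.
have /rowP/(_ a) := zCV; rewrite mxE [RHS]mxE (bigD1 a) //= big1 => [/eqP|b ba].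
  by rewrite addr0 mulf_eq0 (negbTE za) CV; apply/negP; rewrite gw // enum_valP.
have [->|zb] := eqVneq (z 0 b) 0; first by rewrite mul0r.
rewrite CV; apply/eqP; rewrite mulf_eq0; apply/orP; right.
apply/negPn; rewrite gw ?enum_valP //; apply/negP => sub.
case/negP: ba; apply/eqP/enum_val_inj/eqP.
by rewrite eqEcard sub amin.
Qed.

End ZeroPatterns.

(** * Sparse bases *)

(** Descent on [#|U0|]: as long as some subset has a strictly smaller ratio of [f V] to [#|V|], pass
    to it. Ratios are cross-multiplied to stay in [nat]. *)
Lemma min_ratio (T : finType) (f : {set T} -> nat) (U0 : {set T}) :
  U0 != set0 ->
  exists U : {set T}, [/\ U != set0, f U * #|U0| <= f U0 * #|U| &
    forall V : {set T}, V \subset U -> f U * #|V| <= f V * #|U|].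
Proof.
have [m] := ubnP #|U0|; elim: m U0 => // m IH U0 U0m U0n.
have [/forallP H|] := boolP [forall V : {set T}, (V \subset U0) ==> (f U0 * #|V| <= f V * #|U0|)].
  by exists U0; split=> // V VU; exact: (implyP (H V)).
rewrite negb_forall => /existsP[V]; rewrite negb_imply -ltnNge => /andP[VU ltV].
have V0 : 0 < #|V| by case: #|V| ltV; rewrite ?muln0.
have ltVU : #|V| < #|U0|.
  rewrite ltn_neqAle subset_leq_card // andbT; apply/eqP => eqc.
  have eqV : V = U0 by apply/eqP; rewrite eqEcard VU eqc leqnn.
  by rewrite eqV ltnn in ltV.
have [|U [Un leU minU]] := IH V (leq_trans ltVU U0m); first by rewrite -card_gt0.
exists U; split=> //.
rewrite -(leq_pmul2r V0).
rewrite mulnAC; apply: leq_trans (leq_mul leU (leqnn #|U0|)) _.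
by rewrite mulnAC [leqRHS]mulnAC leq_mul2r ltnW ?orbT.
Qed.

Lemma layer_cake (I : Type) (s : seq I) (w : I -> nat) (P : pred I) t :
  (forall i, P i -> w i <= t) ->
  \sum_(i <- s | P i) w i = \sum_(0 <= r < t) count (fun i => P i && (r < w i)) s.
Proof.
move=> wt.
under [RHS]eq_bigr => r _ do rewrite -sum1_count big_mkcondr.
rewrite exchange_big; apply: eq_bigr => i /wt wit /=.
rewrite -big_mkcond sum1_count.
rewrite (_ : index_iota 0 t = index_iota 0 (w i) ++ index_iota (w i) t); last first.
  by rewrite -{1}(subnK wit) addnC /index_iota !subn0 iotaD.
rewrite count_cat; have -> : count (ltn^~ (w i)) (index_iota 0 (w i)) = w i.
  rewrite -[RHS](subn0 (w i)) -[RHS](size_iota 0); apply/eqP; rewrite -all_count.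
  by apply/allP => r; rewrite mem_index_iota.
rewrite (@eq_in_count _ _ pred0) ?count_pred0 ?addn0 // => r.
by rewrite mem_index_iota => /andP[+ _]; rewrite leqNgt => /negbTE.
Qed.

Section RowSpans.
Import GRing.Theory.
Local Open Scope ring_scope.
Variables (F : fieldType) (n p : nat) (A : 'M[F]_(n, p)).
Implicit Types (s b : seq 'I_n) (w : 'I_n -> nat).

Definition rowspan s : 'M[F]_p := (\sum_(i <- s) <<row i A>>)%MS.

Lemma row_rowspan i s : i \in s -> (row i A <= rowspan s)%MS.
Proof.
rewrite /rowspan; elim: s => // j s IH; rewrite inE big_cons => /predU1P[->|/IH].
  by rewrite (submx_trans _ (addsmxSl _ _)) // genmxE.
by move/submx_trans; apply; exact: addsmxSr.
Qed.

Lemma rowspan_sub s m (B : 'M[F]_(m, p)) :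
  (forall i, i \in s -> (row i A <= B)%MS) -> (rowspan s <= B)%MS.
Proof.
rewrite /rowspan; elim: s => [|i s IH] sB; first by rewrite big_nil sub0mx.
rewrite big_cons addsmx_sub genmxE sB ?mem_head //= IH // => j js.
by rewrite sB // inE js orbT.
Qed.

Lemma rowspan_rcons s i : (rowspan (rcons s i) :=: rowspan s + row i A)%MS.
Proof.
rewrite /rowspan -cats1 big_cat big_seq1.
exact: adds_eqmx (eqmx_refl _) (genmxE _).
Qed.

(* The matroid greedy algorithm: scan the rows by increasing weight and keep
   those outside the span of the previous ones. *)
Lemma greedy_basis w s : sorted (fun i j => (w i <= w j)%N) s ->
  exists b, [/\ subseq b s, (rowspan b :=: rowspan s)%MS &
    forall t, count (fun i => (w i <= t)%N) b
            = \rank (rowspan [seq i <- s | (w i <= t)%N])].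
Proof.
elim/last_ind: s => [|s x IH] sw.
  by exists [::]; split=> // t; rewrite /rowspan big_nil mxrank0.
have tr : transitive (fun i j => (w i <= w j)%N).
  by move=> i j k; exact: leq_trans.
have [sws xmax] : sorted (fun i j => (w i <= w j)%N) s /\
    {in s, forall i, (w i <= w x)%N}.
  have := sw; rewrite -cats1 (sorted_pairwise tr) pairwise_cat -(sorted_pairwise tr).
  case/and3P=> /allrelP sx ss _; split=> // i si; apply: sx => //.
  by rewrite inE.
have [b [bs spb cb]] := IH sws.
have filt t : (w x <= t)%N -> [seq i <- rcons s x | (w i <= t)%N] = rcons s x.
  move=> xt; apply/all_filterP; rewrite all_rcons xt; apply/allP => i si.
  exact: leq_trans (xmax i si) xt.
have filts t : (w x <= t)%N -> [seq i <- s | (w i <= t)%N] = s.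
  by move=> xt; apply/all_filterP/allP => i si; exact: leq_trans (xmax i si) xt.
have [xin|xout] := boolP (row x A <= rowspan s)%MS.
  exists b; split.
  - exact: subseq_trans bs (subseq_rcons _ _).
  - apply: eqmx_trans spb _; apply: eqmx_sym; apply: eqmx_trans (rowspan_rcons _ _) _.
    exact: addsmx_idPl.
  move=> t; rewrite cb; have [xt|xt] := leqP (w x) t; last first.
    by rewrite filter_rcons leqNgt xt.
  rewrite filt // filts //.
  by rewrite (rowspan_rcons _ _) (addsmx_idPl xin).
exists (rcons b x); split.
- by rewrite -!cats1 cat_subseq.
- apply: eqmx_trans (rowspan_rcons _ _) _; apply: eqmx_sym.
  apply: eqmx_trans (rowspan_rcons _ _) _; apply: eqmx_sym.
  exact: adds_eqmx.
move=> t; rewrite -cats1 count_cat /= addn0 cb.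
have [xt|xt] := leqP (w x) t; last first.
  by rewrite addn0 filter_rcons leqNgt xt.
rewrite filt // filts // (rowspan_rcons _ _).
have rx : \rank (row x A) = 1%N.
  apply/eqP; rewrite eqn_leq rank_leq_row lt0n mxrank_eq0.
  by apply: contraNneq xout => ->; rewrite sub0mx.
have cap0 : (rowspan s :&: row x A)%MS = 0.
  apply/eqP; rewrite -mxrank_eq0 -leqn0 -ltnS; apply: (@leq_trans (\rank (row x A)));
    last by rewrite rx.
  rewrite ltn_neqAle mxrankS ?capmxSr // andbT.
  apply: contraNneq xout => eqr.
  apply: submx_trans (capmxSl _ (row x A)).
  by rewrite -(mxrank_leqif_sup (capmxSr _ _)) eqr.
by rewrite mxrank_disjoint_sum // rx.
Qed.

(** By the density hypothesis every subset of [U] spans at least its proportional share of the rank.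
    The greedy basis thus takes at least that share from the light rows, and its average weight does
    not exceed that of [U]. *)
Lemma sparse_basis w (U : {set 'I_n}) (k : nat) :
  \rank (rowspan (enum U)) = k ->
  (forall V : {set 'I_n}, V \subset U ->
     (k * #|V| <= \rank (rowspan (enum V)) * #|U|)%N) ->
  exists b, [/\ uniq b, {subset b <= U}, size b = k,
    (rowspan (enum U) <= rowspan b)%MS
    & (#|U| * \sum_(i <- b) w i <= k * \sum_(i in U) w i)%N].
Proof.
move=> rU dense.
have tot : total (fun i j => (w i <= w j)%N) by move=> i j; exact: leq_total.
have eqspan s s' : s =i s' -> (rowspan s :=: rowspan s')%MS.
  move=> ss; apply/eqmxP/andP.
  by split; apply: rowspan_sub => i; [rewrite ss|rewrite -ss]; exact: row_rowspan.
pose s := sort (fun i j => (w i <= w j)%N) (enum U).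
have [b [bs spb cb]] := greedy_basis (sort_sorted tot (enum U)).
have sU : s =i U by move=> i; rewrite mem_sort mem_enum.
have bU : {subset b <= U} by move=> i /(mem_subseq bs); rewrite sU.
have szs (P : pred 'I_n) : size [seq i <- enum U | P i] = #|[set i in U | P i]|.
  rewrite cardE; apply/perm_size/uniq_perm;
    [exact: filter_uniq (enum_uniq _) | exact: enum_uniq | move=> i].
  by rewrite mem_filter !mem_enum !inE andbC.
pose t := (\max_i w i)%N.
have wt i : (w i <= t)%N by exact: leq_bigmax.
have szb : size b = k.
  have := cb t; rewrite (eq_count (a2 := predT)) ?count_predT // => ->.
  rewrite (all_filterP _) /=; last by apply/allP.
  by rewrite -rU; apply/eqmx_rank/eqmxP/eqspan => i; rewrite sU mem_enum.
exists b; split=> //.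
- by rewrite (subseq_uniq bs) // sort_uniq enum_uniq.
- rewrite spb; have := eqspan s (enum U); move=> -> //.
  by move=> i; rewrite sU mem_enum.
(* Layer by layer, the rows of weight [> r] in [b] number [k] minus the rank of
   the rows of weight [<= r], which density bounds from below. *)
rewrite (@layer_cake _ b w _ t) // -big_enum (@layer_cake _ _ w _ t) // !big_distrr /=.
apply: leq_sum => r _.
have split s' : size s' = (count (fun i => (w i <= r)%N) s' + count (fun i => (r < w i)%N) s')%N.
  rewrite -(count_predC (fun i => (w i <= r)%N)); congr (_ + _)%N.
  by apply: eq_count => i /=; rewrite ltnNge.
rewrite -(leq_add2l (#|U| * count (fun i => (w i <= r)%N) b)) -mulnDr -split szb.
rewrite cb.
have := dense [set i in U | (w i <= r)%N] _.
have -> : \rank (rowspan [seq i <- s | (w i <= r)%N])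
    = \rank (rowspan (enum [set i in U | (w i <= r)%N])).
  by apply/eqmx_rank/eqmxP/eqspan => i; rewrite mem_filter mem_enum !inE sU andbC.
have cU : #|U| = (count (fun i => (w i <= r)%N) (enum U)
                 + count (fun i => (r < w i)%N) (enum U))%N by rewrite cardE split.
rewrite -szs size_filter [X in _ -> (X <= _)%N]mulnC => le.
rewrite [X in (k * X <= _)%N]cU mulnDr leq_add2r [leqRHS]mulnC; apply: le.
by apply/subsetP => i; rewrite inE => /andP[].
Qed.

End RowSpans.

(** * Sparse principal submatrices *)

Lemma leq_card_bigcup (I T : finType) (r : seq I) (B : I -> {set T}) :
  #|\bigcup_(i <- r) B i| <= \sum_(i <- r) #|B i|.
Proof.
apply: (big_ind2 (fun (X : {set T}) m => #|X| <= m)) => [|X m Y m' Xm Ym|//].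
  by rewrite cards0.
by rewrite cardsU (leq_trans (leq_subr _ _)) // leq_add.
Qed.

Section SparsePatterns.
Import GRing.Theory.
Local Open Scope ring_scope.
Variables (F : fieldType) (n : nat).
Implicit Types (A M : 'M[F]_n) (U V : {set 'I_n}).

Definition supp M : {set 'I_n * 'I_n} := [set x | M x.1 x.2 != 0].

(** Principal submatrix padded with zeros, so that all of them have the same type. *)
Definition mask U M : 'M[F]_n :=
  \matrix_(i, j) if (i \in U) && (j \in U) then M i j else 0.

Definition rowwt A i : nat := #|[set j | A i j != 0]|.

Lemma mask_tr U M : mask U M^T = (mask U M)^T.
Proof. by apply/matrixP => i j; rewrite !mxE andbC. Qed.

Lemma mask_setT M : mask [set: 'I_n] M = M.
Proof. by apply/matrixP => i j; rewrite !mxE !in_setT. Qed.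

(** Restricting the rows in [V] to the columns in [V] is multiplication by a diagonal 0/1 matrix,
    which cannot raise the rank. *)
Lemma rank_mask_sub U V M : V \subset U ->
  (\rank (mask V M) <= \rank (rowspan (mask U M) (enum V)))%N.
Proof.
move=> VU; pose D := diag_mx (\row_(i < n) (i \in V)%:R) : 'M[F]_n.
have -> : mask V M = D *m mask U M *m D.
  apply/matrixP => i j; rewrite mul_mx_diag mul_diag_mx !mxE.
  have [iV|_] := boolP (i \in V); last by rewrite !mul0r.
  have [jV|_] := boolP (j \in V); last by rewrite mulr0.
  by rewrite !(subsetP VU) // mul1r mulr1.
apply: leq_trans (mxrankM_maxl _ _) (mxrankS _).
apply/row_subP => i; have -> : row i (D *m mask U M) = (i \in V)%:R *: row i (mask U M).
  by apply/rowP => j; rewrite mul_diag_mx !mxE.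
have [iV|_] := boolP (i \in V); last by rewrite scale0r sub0mx.
by rewrite scalemx_sub // row_rowspan // mem_enum.
Qed.

Lemma mask_sub_rowspan U M : (mask U M <= rowspan (mask U M) (enum U))%MS.
Proof.
apply/row_subP => i; have [iU|iU] := boolP (i \in U).
  by rewrite row_rowspan // mem_enum.
have -> : row i (mask U M) = 0; last exact: sub0mx.
by apply/rowP => j; rewrite !mxE (negbTE iU).
Qed.

(** Minimality of the rank ratio among principal submatrices gives the density hypothesis of
    [sparse_basis], through [rank_mask_sub]. *)
Lemma masked_basis U M :
  (forall V, V \subset U ->
     (\rank (mask U M) * #|V| <= \rank (mask V M) * #|U|)%N) ->
  exists b, [/\ uniq b, size b = \rank (mask U M),
    (mask U M <= rowspan (mask U M) b)%MS
    & (#|U| * \sum_(i <- b) rowwt (mask U M) i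
       <= \rank (mask U M) * #|supp (mask U M)|)%N].
Proof.
move=> dense; set k := \rank _ in dense *.
have rk : \rank (rowspan (mask U M) (enum U)) = k.
  apply/eqP; rewrite eqn_leq; apply/andP; split; apply: mxrankS.
    by apply: rowspan_sub => i _; exact: row_sub.
  exact: mask_sub_rowspan.
have [V VU|b [ub bU sb spb wb]] :=
    sparse_basis (rowwt (mask U M)) rk.
  by apply: leq_trans (dense V VU) _; rewrite leq_mul2r rank_mask_sub ?orbT.
exists b; split=> //; first exact: submx_trans (mask_sub_rowspan U M) spb.
apply: leq_trans wb _; rewrite leq_mul2l; apply/orP; right.
have -> : (#|supp (mask U M)| = \sum_i rowwt (mask U M) i)%N.
  rewrite -sum1_card; under [RHS]eq_bigr => i _ do rewrite /rowwt -sum1_card.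
  rewrite pair_big_dep /=; apply: eq_bigl => -[i j] /=.
  by rewrite !inE.
by rewrite big_mkcond; apply: leq_sum => i _; case: ifP.
Qed.

(** Let [B] be the core [mxsub f g A]. If [A] is [X] times its chosen rows, then its chosen columns
    are [X *m B]. As these columns generate [A], rank [k] forces [B] to be invertible, and
    [B *m \adj B] is the scalar matrix of [\det B]. *)
Lemma skeleton_decomposition k A (f g : 'I_k -> 'I_n) :
  (A <= rowsub f A)%MS -> (A^T <= rowsub g A^T)%MS -> \rank A = k ->
  \det (mxsub f g A) != 0 /\
  colsub g A *m \adj (mxsub f g A) *m rowsub f A = \det (mxsub f g A) *: A.
Proof.
move=> /submxP[X AX] /submxP[Y AY] rA.
have cA : colsub g A = X *m mxsub f g A.
  by rewrite {1}AX -mulmx_colsub; congr (_ *m _); apply/matrixP => i j; rewrite !mxE.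
have AgY : A = colsub g A *m Y^T.
  by rewrite -[LHS]trmxK AY trmx_mul; congr (_ *m _); apply/matrixP => i j; rewrite !mxE.
split.
  rewrite -unitfE -unitmxE -row_free_unit /row_free eqn_leq rank_leq_row /=.
  rewrite -[X in (X <= _)%N]rA {1}AgY cA -mulmxA.
  by apply: leq_trans (mxrankM_maxr _ _) (mxrankM_maxl _ _).
rewrite cA -(mulmxA X) mul_mx_adj mul_mx_scalar -scalemxAl.
by congr (_ *: _); rewrite -AX.
Qed.

(** Values at a repeated position add up, so a list of positions can be padded using the value 0. *)
Definition spmx N (L : 'I_N -> 'I_n * 'I_n) (u : 'I_N -> F) : 'M[F]_n :=
  \matrix_(i, j) \sum_(t | L t == (i, j)) u t.

(** The adjugate stands for the inverse of the core, which makes the entries polynomial in [u]; the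
    price is a determinant factor, harmless for zero-patterns when nonzero. *)
Definition skeleton k N (f g : 'I_k -> 'I_n) (L : 'I_N -> 'I_n * 'I_n) u :=
  colsub g (spmx L u) *m \adj (mxsub f g (spmx L u)) *m rowsub f (spmx L u).

(** Each outer factor contributes degree 1, and the adjugate, made of minors of order [k.-1], at
    most [k]. *)
Lemma polyfun_skeleton k N (f g : 'I_k -> 'I_n) (L : 'I_N -> 'I_n * 'I_n) i j :
  polyfun (k + 2) (fun u => skeleton f g L u i j).
Proof.
have P1 i' j' : polyfun 1 (fun u => spmx L u i' j').
  apply: polyfun_ext (polyfun_sum _ _ (@polyfun_var F N)) => u.
  by rewrite mxE.
(* The entries of the adjugate are written as cofactors, with the Leibniz formula for the minors. *)
have E u : \sum_(b < k) (\sum_(a < k) spmx L u i (g a) *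
    ((-1) ^+ (b + a) * \sum_(s : 'S_k.-1) (-1) ^+ s *
      \prod_c spmx L u (f (lift b c)) (g (lift a (s c))))) * spmx L u (f b) j
    = skeleton f g L u i j.
  rewrite mxE; apply: eq_bigr => b _; rewrite !mxE; congr (_ * _).
  apply: eq_bigr => a _; rewrite !mxE; congr (_ * (_ * _)).
  apply: eq_bigr => s _; congr (_ * _); apply: eq_bigr => c _.
  by rewrite !mxE.
apply: (polyfun_ext E).
rewrite (_ : k + 2 = 1 + k + 1)%N; last by rewrite addnAC addnC.
apply: polyfun_sum => b; apply: polyfunM => //.
apply: polyfun_sum => a; apply: polyfunM => //.
apply: (@polyfunM _ _ 0 k); first exact: polyfun_const.
apply: polyfun_sum => s; apply: (@polyfunM _ _ 0 k); first exact: polyfun_const.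
apply: (@polyfun_leq _ _ (#|'I_k.-1| * 1)).
  by rewrite card_ord muln1 leq_pred.
exact: polyfun_prod.
Qed.

(* [L] lists the positions of the nonzero entries of the two bases and [u] their
   values; only [u] is subject to the zero-pattern count. *)
Lemma card_skeleton_patterns k N (P : {set {set 'I_n * 'I_n}}) :
  (forall S, S \in P -> exists (f g : {ffun 'I_k -> 'I_n})
     (L : {ffun 'I_N -> 'I_n * 'I_n}) u, S = supp (skeleton f g L u)) ->
  (#|P| <= n ^ k * n ^ k * (n * n) ^ N * ((n * n) * (k + 2)).+1 ^ N)%N.
Proof.
move=> hP.
pose Q := ({ffun 'I_k -> 'I_n} * {ffun 'I_k -> 'I_n} * {ffun 'I_N -> 'I_n * 'I_n})%type.
have [S0 S0P|P0] := pickP (mem P); last by rewrite eq_card0.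
(* Choose one triple [(f, g, L)] for each pattern; the patterns sharing a triple are then
   zero-patterns of one fixed family of polynomials in [u]. *)
have [c hc] : exists c : {set 'I_n * 'I_n} -> Q, forall S, S \in P ->
    exists u, S = supp (skeleton (c S).1.1 (c S).1.2 (c S).2 u).
  have [f [g [L [u _]]]] := hP S0 S0P.
  apply: (fin_all_exists (P := fun S (q : Q) => S \in P ->
    exists u, S = supp (skeleton q.1.1 q.1.2 q.2 u))) => S.
  case SP: (S \in P); last by exists (f, g, L).
  by have [f' [g' [L' [u' Su]]]] := hP S SP; exists (f', g', L') => _; exists u'.
have -> : #|P| = (\sum_(q : Q) #|[set S in P | c S == q]|)%N.
  rewrite -sum1_card (partition_big c predT) //; apply: eq_bigr => q _.
  by rewrite -sum1_card; apply: eq_bigl => S; rewrite inE.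
apply: (@leq_trans (\sum_(q : Q) ((n * n) * (k + 2)).+1 ^ N)%N); last first.
  by rewrite sum_nat_const !card_prod !card_ffun card_prod !card_ord.
apply: leq_sum => -[[f g] L] _.
have -> : (n * n = #|{: 'I_n * 'I_n}|)%N by rewrite card_prod card_ord.
apply: (@zero_patterns F N _ (fun x u => skeleton f g L u x.1 x.2)) => [x|S].
  exact: polyfun_skeleton.
by rewrite inE => /andP[SP /eqP cS]; have := hc S SP; rewrite cS.
Qed.

Lemma spmx_restrict N (x0 : 'I_n * 'I_n) A (Z : {set 'I_n * 'I_n}) : (#|Z| <= N)%N ->
  exists (L : {ffun 'I_N -> 'I_n * 'I_n}) u, forall i j,
    spmx L u i j = if (i, j) \in Z then A i j else 0.
Proof.
(* Indices beyond [#|Z|] fall on the default position [x0] with value 0 and contribute nothing. *)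
move=> ZN; exists [ffun t : 'I_N => nth x0 (enum Z) t],
  (fun t => let x := nth x0 (enum Z) t in if (t < #|Z|)%N then A x.1 x.2 else 0) => i j.
rewrite mxE; case: ifP => ijZ.
  have ltZ : (index (i, j) (enum Z) < #|Z|)%N by rewrite cardE index_mem mem_enum.
  have ltN := leq_trans ltZ ZN.
  have nthZ : nth x0 (enum Z) (index (i, j) (enum Z)) = (i, j).
    by rewrite nth_index // mem_enum.
  rewrite (bigD1 (Ordinal ltN)) /=; last by rewrite ffunE nthZ.
  rewrite ltZ nthZ big1 ?addr0 // => t /andP[]; rewrite ffunE => /eqP tij tN.
  case: ifP => // tZ; case/negP: tN; apply/eqP/val_inj => /=.
  by rewrite -tij index_uniq // ?enum_uniq // -cardE.
rewrite big1 // => t; rewrite ffunE => /eqP tij; rewrite tij /=; case: ifP => tZ //.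
have : nth x0 (enum Z) t \in enum Z by rewrite mem_nth // -cardE.
by rewrite tij mem_enum ijZ.
Qed.

Lemma sub_rowsub_nth A b (i0 : 'I_n) k : size b = k ->
  (rowspan A b <= rowsub (fun a : 'I_k => nth i0 b a) A)%MS.
Proof.
move=> sb; apply: rowspan_sub => i ib.
have lt : (index i b < k)%N by rewrite -sb index_mem.
have -> : row i A = row (Ordinal lt) (rowsub (fun a : 'I_k => nth i0 b a) A).
  by rewrite row_rowsub /= nth_index.
exact: row_sub.
Qed.

(** Since the diagonal of [M] is nonzero, the size [m] of the submatrix is read off its support [S].
    The length of [L] leaves room for a row basis and a column basis with at most [#|S| * k %/ m]
    nonzero entries each. *)
Lemma sparse_skeleton M : (0 < n)%N -> (forall i, M i i != 0) ->
  exists S : {set 'I_n * 'I_n},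
  let m := #|[set i | (i, i) \in S]| in
  exists k : nat,
  [/\ S \subset supp M, (0 < m)%N, (k * n <= \rank M * m)%N,
      (m * m <= #|S| * k)%N &
      exists (f g : {ffun 'I_k -> 'I_n})
        (L : {ffun 'I_(2 * (#|S| * k %/ m)) -> 'I_n * 'I_n}) u,
      S = supp (skeleton f g L u)].
Proof.
move=> n0 Md.
have [|U [Un Ur Umin]] := @min_ratio 'I_n (fun V => \rank (mask V M)) [set: 'I_n].
  by apply/set0Pn; exists (Ordinal n0).
set A := mask U M; set k := \rank A.
have diagA : [set i | (i, i) \in supp A] = U.
  apply/setP => i; rewrite !inE mxE andbb; case: (i \in U) => /=.
    by rewrite Md.
  by rewrite eqxx.
exists (supp A); rewrite diagA; exists k.
have m0 : (0 < #|U|)%N by rewrite card_gt0.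
have [b1 [ub1 sb1 spb1 wb1]] := masked_basis Umin.
(* The column basis is a row basis of the transpose, where minimality persists because ranks do. *)
have [V VU|b2 [ub2 sb2 spb2 wb2]] := @masked_basis U M^T.
  by rewrite !mask_tr !mxrank_tr; exact: Umin.
rewrite -/A -/k in sb1 spb1 wb1.
rewrite !mask_tr mxrank_tr -/A -/k in sb2 spb2 wb2.
have suppT : #|supp A^T| = #|supp A|.
  have -> : supp A^T = (fun x => (x.2, x.1)) @^-1: supp A.
    by apply/setP => x; rewrite !inE mxE.
  rewrite on_card_preimset //; exists (fun x => (x.2, x.1)) => -[x y] //.
rewrite suppT in wb2.
set W := (#|supp A| * k %/ #|U|)%N.
have W1 : (\sum_(i <- b1) rowwt A i <= W)%N.
  by rewrite leq_divRL // mulnC [leqRHS]mulnC.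
have W2 : (\sum_(j <- b2) rowwt A^T j <= W)%N.
  by rewrite leq_divRL // mulnC [leqRHS]mulnC.
pose f := [ffun a : 'I_k => nth (Ordinal n0) b1 a].
pose g := [ffun a : 'I_k => nth (Ordinal n0) b2 a].
have fb1 a : f a \in b1 by rewrite ffunE mem_nth // sb1.
have gb2 a : g a \in b2 by rewrite ffunE mem_nth // sb2.
have Af : (A <= rowsub f A)%MS.
  apply: submx_trans spb1 (submx_trans (sub_rowsub_nth A (Ordinal n0) sb1) _).
  by rewrite (_ : rowsub f A = rowsub (fun a : 'I_k => nth (Ordinal n0) b1 a) A) //;
    apply/matrixP => i j; rewrite !mxE ffunE.
have Ag : (A^T <= rowsub g A^T)%MS.
  apply: submx_trans spb2 (submx_trans (sub_rowsub_nth A^T (Ordinal n0) sb2) _).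
  by rewrite (_ : rowsub g A^T = rowsub (fun a : 'I_k => nth (Ordinal n0) b2 a) A^T) //;
    apply/matrixP => i j; rewrite !mxE ffunE.
have [detA skA] := skeleton_decomposition Af Ag erefl.
split=> //.
- apply/subsetP => x; rewrite !inE mxE; case: ifP => //; by rewrite eqxx.
- by move: Ur; rewrite cardsT card_ord mask_setT.
(* The basis rows generate [A] and [A j j != 0] for [j] in [U], so every column of [U] meets a
   nonzero entry of a basis row. *)
- have UW : (#|U| <= W)%N; last first.
    by rewrite (leq_trans _ (leq_trunc_div _ #|U|)) // leq_mul2r UW orbT.
  apply: leq_trans W1; apply: leq_trans (leq_card_bigcup _ _).
  apply/subset_leq_card/subsetP => j jU.
  have [X AX] := submxP Af.
  have : A j j != 0 by rewrite mxE jU Md.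
  rewrite {1}AX mxE => /eqP s0.
  have [a fa] : exists a, A (f a) j != 0.
    apply/existsP; apply: contra_notT s0; rewrite negb_exists => /forallP az.
    by apply: big1 => a _; rewrite [rowsub f A a j]mxE (eqP (negPn (az a))) mulr0.
  by rewrite (big_rem (f a)) //= inE [X in X || _]inE fa.
(* Storing the entries of [A] on the basis rows and columns suffices, because [skeleton] reads no
   others. *)
pose Z := [set x in supp A | (x.1 \in b1) || (x.2 \in b2)].
have ZW : (#|Z| <= 2 * W)%N.
  rewrite mul2n -addnn; apply: leq_trans (leq_add W1 W2).
  pose Z1 := \bigcup_(i <- b1) [set (i, j) | j in [set j | A i j != 0]].
  pose Z2 := \bigcup_(j <- b2) [set (i, j) | i in [set i | A^T j i != 0]].
  apply: (@leq_trans (#|Z1| + #|Z2|)).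
    rewrite (leq_trans _ (leq_card_setU _ _)) // subset_leq_card //.
    apply/subsetP => -[i j]; rewrite !inE /= => /andP[Aij /orP[ib|jb]].
      by rewrite /Z1 (big_rem i) //= inE imset_f ?inE.
    by apply/orP; right; rewrite /Z2 (big_rem j) //= inE (imset_f (fun i => (i, j))) // inE mxE.
  by rewrite leq_add // (leq_trans (leq_card_bigcup _ _)) //; apply: leq_sum => i _;
    exact: leq_imset_card.
have [L [u Lu]] := spmx_restrict (Ordinal n0, Ordinal n0) A ZW.
exists f, g, L, u.
have rows a j : spmx L u (f a) j = A (f a) j.
  rewrite Lu !inE fb1 andbT; case: ifP => // /negbFE/eqP->//.
have cols a i : spmx L u i (g a) = A i (g a).
  rewrite Lu !inE gb2 orbT andbT; case: ifP => // /negbFE/eqP->//.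
have -> : skeleton f g L u = \det (mxsub f g A) *: A.
  have e1 : rowsub f (spmx L u) = rowsub f A.
    by apply/matrixP => a j; rewrite mxE [RHS]mxE rows.
  have e2 : colsub g (spmx L u) = colsub g A.
    by apply/matrixP => i a; rewrite mxE [RHS]mxE cols.
  have e3 : mxsub f g (spmx L u) = mxsub f g A.
    by apply/matrixP => a a'; rewrite mxE [RHS]mxE rows.
  by rewrite -skA /skeleton e1 e2 e3.
apply/setP => x; rewrite !inE [X in _ = ~~ (X == 0)]mxE mulf_eq0 negb_or.
by rewrite detA.
Qed.

End SparsePatterns.

(** * Random subsets *)

Section RealSums.
Local Open Scope R_scope.

HB.instance Definition _ :=
  Monoid.isComLaw.Build R 0 Rplus (fun x y z => esym (Rplus_assoc x y z)) Rplus_comm Rplus_0_l.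
HB.instance Definition _ := Monoid.isMulLaw.Build R 0 Rmult Rmult_0_l Rmult_0_r.
HB.instance Definition _ := Monoid.isAddLaw.Build R Rmult Rplus
  Rmult_plus_distr_r Rmult_plus_distr_l.

Lemma Rsum_le (I : Type) (r : seq I) (P : pred I) (f g : I -> R) :
  (forall i, P i -> f i <= g i) ->
  \big[Rplus/0]_(i <- r | P i) f i <= \big[Rplus/0]_(i <- r | P i) g i.
Proof.
by move=> fg; apply: (big_ind2 Rle) => //; [exact: Rle_refl | move=> *; exact: Rplus_le_compat].
Qed.

Lemma Rsum_const (I : finType) (P : pred I) (a : R) :
  \big[Rplus/0]_(i | P i) a = INR #|P| * a.
Proof.
rewrite big_const; elim: #|P| => [|m IH]; first by rewrite /=; lra.
by rewrite S_INR iterS IH; lra.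
Qed.

End RealSums.

Section RandomSubset.
Local Open Scope R_scope.
Variables (T : finType) (p : R).
Implicit Types (A B S E : {set T}) (f g : {set T} -> R).

(** Expectation over a random subset of [A] that keeps each element independently with probability
    [p]. *)
Definition Ex A f : R :=
  \big[Rplus/0]_(E : {set T} | E \subset A)
    (p ^ #|E| * (1 - p) ^ (#|A| - #|E|) * f E).

Lemma eq_Ex A f g : (forall E, E \subset A -> f E = g E) -> Ex A f = Ex A g.
Proof. by move=> fg; apply: eq_bigr => E /fg->. Qed.

(** Independence of the traces on disjoint sets: [E] corresponds to the pair of its intersections
    with [A] and [B], and the weights multiply. *)
Lemma ExU A B f : [disjoint A & B] ->
  Ex (A :|: B) f = Ex A (fun E => Ex B (fun E' => f (E :|: E'))).
Proof.
move=> dAB.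
have capA E E' : E \subset A -> E' \subset B -> (E :|: E') :&: A = E.
  move=> EA EB; rewrite setIUl (setIidPl EA); apply/setUidPl/subsetP => x.
  rewrite inE => /andP[/(subsetP EB) xB xA].
  by move: dAB; rewrite -setI_eq0 => /eqP/setP/(_ x); rewrite !inE xA xB.
have capB E E' : E \subset A -> E' \subset B -> (E :|: E') :&: B = E'.
  move=> EA EB; rewrite setIUl (setIidPl EB); apply/setUidPr/subsetP => x.
  rewrite inE => /andP[/(subsetP EA) xA xB].
  by move: dAB; rewrite -setI_eq0 => /eqP/setP/(_ x); rewrite !inE xA xB.
have dsub E E' : E \subset A -> E' \subset B -> #|E :|: E'| = (#|E| + #|E'|)%N.
  move=> EA EB; apply/eqP; rewrite (leq_card_setU E E').2.
  exact: disjointWl EA (disjointWr EB dAB).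
rewrite /Ex; under [RHS]eq_bigr => E _ do rewrite big_distrr.
rewrite pair_big /= (reindex_onto (fun q : {set T} * {set T} => q.1 :|: q.2)
  (fun E => (E :&: A, E :&: B))) /=; last first.
  by move=> E EAB; rewrite -setIUr; apply/setIidPl.
apply: eq_big => [[E E']|[E E'] /andP[EAB /eqP[eA eB]]] /=.
  apply/andP/andP => [[EAB /eqP[<- <-]]|[EA EB]]; first by rewrite !subsetIr.
  by rewrite setUSS // capA // capB.
rewrite /= in EAB eA eB.
have EA : E \subset A by rewrite -eA subsetIr.
have EB : E' \subset B by rewrite -eB subsetIr.
rewrite !dsub // pow_add.
have -> : (#|A| + #|B| - (#|E| + #|E'|) = (#|A| - #|E|) + (#|B| - #|E'|))%N.
  by rewrite addnBA ?subset_leq_card // addnBAC ?subset_leq_card // subnDA.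
by rewrite pow_add; ring.
Qed.

Lemma Ex0 f : Ex set0 f = f set0.
Proof.
rewrite /Ex (big_pred1 set0) => [|E]; last by rewrite subset0.
by rewrite cards0 /=; ring.
Qed.

Lemma Ex1 (x : T) f : Ex [set x] f = p * f [set x] + (1 - p) * f set0.
Proof.
rewrite /Ex (bigD1 [set x]) //= (big_pred1 set0) => [|E].
  by rewrite !cards1 cards0 /=; ring.
rewrite subset1; case: eqP => [->|] /=; last by rewrite andbT.
by apply/esym/eqP => /setP/(_ x); rewrite !inE eqxx.
Qed.

Lemma Ex_const A (a : R) : Ex A (fun=> a) = a.
Proof.
elim: {A}#|A| {-2}A (erefl #|A|) => [A /cards0_eq->|m IH A Am]; first exact: Ex0.
have [x xA] : exists x, x \in A by apply/set0Pn; rewrite -card_gt0 Am.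
rewrite -(setD1K xA) ExU; last by rewrite disjoints1 !inE eqxx.
rewrite (eq_Ex (g := fun=> a)) => [|E _]; first by rewrite Ex1; ring.
by apply: IH; move: Am; rewrite (cardsD1 x) xA => -[].
Qed.

Lemma Ex_scale A (a : R) f : Ex A (fun E => a * f E) = a * Ex A f.
Proof. by rewrite /Ex big_distrr; apply: eq_bigr => E _ /=; ring. Qed.

Lemma ExD A f g : Ex A (fun E => f E + g E) = Ex A f + Ex A g.
Proof. by rewrite /Ex -big_split; apply: eq_bigr => E _ /=; ring. Qed.

Lemma Ex_sum (I : finType) (P : pred I) A (h : I -> {set T} -> R) :
  Ex A (fun E => \big[Rplus/0]_(i | P i) h i E)
  = \big[Rplus/0]_(i | P i) Ex A (h i).
Proof.
rewrite /Ex exchange_big; apply: eq_bigr => E _.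
by rewrite big_distrr.
Qed.

Lemma Ex_superset A S : S \subset A ->
  Ex A (fun E => if S \subset E then 1 else 0) = p ^ #|S|.
Proof.
move=> SA; rewrite -[in Ex A](setID A S) (setIidPr SA) ExU; last first.
  by rewrite disjoint_sym disjoints_subset subsetDr.
transitivity (Ex S (fun E => if E == S then 1 else 0)).
  apply: eq_Ex => E ES; rewrite -[RHS](Ex_const (A :\: S)); apply: eq_Ex => E' E'A.
  rewrite eqEsubset ES /=; congr (if _ then _ else _).
  apply/subsetP/subsetP => sub x xS; last by rewrite inE sub.
  have := sub x xS; rewrite inE => /orP[//|/(subsetP E'A)].
  by rewrite inE xS.
rewrite /Ex (bigD1 S) //= eqxx subnn /= big1 => [|E /andP[_ /negbTE->]]; by ring.
Qed.

Hypotheses (p0 : 0 <= p) (p1 : p <= 1).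

Lemma Ex_le A f g : (forall E, E \subset A -> f E <= g E) -> Ex A f <= Ex A g.
Proof.
move=> fg; apply: Rsum_le => E EA; apply: Rmult_le_compat_l (fg E EA).
by apply: Rmult_le_pos; apply: pow_le; lra.
Qed.

(** Disjoint target sets are missed independently, each with probability at most [1 - p ^ l]; the
    induction splits off the first target. *)
Lemma Ex_avoid A l (s : seq {set T}) :
  pairwise (fun S S' : {set T} => [disjoint S & S']) s ->
  (forall S, S \in s -> S \subset A /\ (#|S| <= l)%N) ->
  Ex A (fun E => if has (fun S : {set T} => S \subset E) s then 0 else 1)
    <= (1 - p ^ l) ^ size s.
Proof.
elim: s A => [|S s IH] A /=; first by rewrite Ex_const => *; exact: Rle_refl.
move=> /andP[/allP dS ps] sA.
have [SA Sl] := sA S (mem_head _ _).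
rewrite -[in Ex A](setID A S) (setIidPr SA) ExU; last first.
  by rewrite disjoint_sym disjoints_subset subsetDr.
set X := Ex (A :\: S) (fun E => if has (fun S : {set T} => S \subset E) s then 0 else 1).
have X0 : 0 <= X.
  rewrite -(Ex_const (A :\: S) 0); apply: Ex_le => E _; case: ifP => _; lra.
(* Given the trace [E] on [S], the conditional probability is 0 if [S] is hit and [X] otherwise, as
   the remaining targets do not meet [S]. *)
transitivity (Ex S (fun E => X + (- X) * if S \subset E then 1 else 0)).
  apply: Req_le; apply: eq_Ex => E ES; case: ifP => SE.
    transitivity (Ex (A :\: S) (fun=> 0)); last by rewrite Ex_const; ring.
    by apply: eq_Ex => E' _; rewrite (subset_trans SE) ?subsetUl.
  transitivity X; last by ring.
  apply: eq_Ex => E' E'A.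
  have -> : S \subset E :|: E' = false.
    apply: contraFF SE => /subsetP SEE'; apply/subsetP => x xS.
    by have := SEE' x xS; rewrite inE => /orP[//|/(subsetP E'A)]; rewrite inE xS.
  rewrite /=; congr (if _ then _ else _); apply: eq_in_has => S' S's.
  apply/idP/idP => [/subsetP sub|/subset_trans->//]; last exact: subsetUr.
  apply/subsetP => x xS'; have := sub x xS'; rewrite inE => /orP[/(subsetP ES) xS|//].
  by have := disjointFr (dS S' S's) xS; rewrite xS'.
rewrite ExD Ex_const Ex_scale Ex_superset //.
have /IH : pairwise (fun S S' : {set T} => [disjoint S & S']) s by [].
move=> /(_ (A :\: S)) H.
have {}H : X <= (1 - p ^ l) ^ size s.
  apply: H => S' S's; have [S'A S'l] := sA S' (mem_behead (s := S :: s) S's).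
  split=> //; rewrite subsetD S'A disjoint_sym; exact: dS.
have pl : p ^ l <= p ^ #|S|.
  rewrite -(subnKC Sl) pow_add -[X in _ <= X]Rmult_1_r.
  apply: Rmult_le_compat_l; first exact: pow_le.
  by rewrite -(pow1 (l - #|S|)); apply: pow_incr.
have pS : 0 <= p ^ l by exact: pow_le.
have : p ^ #|S| <= 1 by rewrite -(pow1 #|S|); apply: pow_incr.
nra.
Qed.

End RandomSubset.

(** * The lower bound *)

Section Minrank.
Variables (F : fieldType) (n : nat).
Implicit Types (E : {set 'I_n * 'I_n}) (M : 'M[F]_n).

Lemma minrank_fits E : exists2 M : 'M[F]_n, fits E M & \rank M <= minrank F E.
Proof.
rewrite /minrank; case: ex_minnP => k + _; rewrite /minrank_pred.
by case: excluded_middle_informative => // -[M [fM rM]] _; exists M.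
Qed.

Lemma minrank_le E M : fits E M -> minrank F E <= \rank M.
Proof.
move=> fM; rewrite /minrank; case: ex_minnP => k _; apply; rewrite /minrank_pred.
by case: excluded_middle_informative => // -[]; exists M.
Qed.

Lemma minrank_leq_size E : minrank F E <= n.
Proof.
have [M fM _] := minrank_fits E.
exact: leq_trans (minrank_le fM) (rank_leq_row M).
Qed.

(** The edges forced on a graph by a fitting matrix that is nonzero on [S]. *)
Definition edges_of (S : {set 'I_n * 'I_n}) : {set 'I_n * 'I_n} :=
  [set x in upairs n | (x \in S) || ((x.2, x.1) \in S)].

Lemma edges_of_fits E M (S : {set 'I_n * 'I_n}) :
  E \subset upairs n -> fits E M -> S \subset supp M -> edges_of S \subset E.
Proof.
move=> EU [_ fM] SM; apply/subsetP => x; rewrite !inE => /andP[x12 xS].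
have nadj i j : i != j -> (i, j) \in S -> adj E i j.
  move=> ij /(subsetP SM); rewrite inE /=; apply: contraR => naij.
  by apply/eqP; exact: fM.
have n12 : x.1 != x.2 by rewrite neq_ltn x12.
have : adj E x.1 x.2.
  case/orP: xS => [xS|/nadj]; first by apply: nadj => //; rewrite -surjective_pairing.
  by rewrite eq_sym /adj orbC; apply.
rewrite /adj -surjective_pairing => /orP[//|/(subsetP EU)].
by rewrite inE /= ltnNge ltnW.
Qed.

(** An edge comes from at most two positions, and all other positions are diagonal. *)
Lemma card_edges_of (S : {set 'I_n * 'I_n}) :
  #|S| <= 2 * #|edges_of S| + #|[set i | (i, i) \in S]|.
Proof.
pose sw (x : 'I_n * 'I_n) := (x.2, x.1).
rewrite mul2n -addnn.
apply: leq_trans (leq_add (leq_add (leqnn _) (leq_imset_card sw (edges_of S)))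
  (leq_imset_card (fun i => (i, i)) [set i | (i, i) \in S])).
apply: leq_trans (leq_add (leq_card_setU _ _).1 (leqnn _)).
apply: leq_trans (leq_card_setU _ _).1.
apply/subset_leq_card/subsetP => -[i j] ijS; rewrite !inE ijS /=.
case: (ltngtP i j) => [//|ji|/val_inj eij].
  apply/orP; left; apply/orP; right; apply/imsetP; exists (j, i) => //.
  by rewrite !inE /= ji ijS orbT.
by apply/orP; right; apply/imsetP; exists i; rewrite ?inE -?eij // {2}eij.
Qed.

End Minrank.

(** * First moment bound over sparse patterns *)

Section Tail.
Local Open Scope R_scope.

Lemma gnp_probE n p (Q : {set 'I_n * 'I_n} -> Prop) :
  gnp_prob p Q = Ex p (upairs n)
    (fun E => if excluded_middle_informative (Q E) then 1 else 0).
Proof.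
transitivity (\big[Rplus/0]_(E <- graphs n)
    (gnp_weight p E * if excluded_middle_informative (Q E) then 1 else 0)).
  rewrite /gnp_prob; elim: (graphs n) => [|E s IH]; first by rewrite big_nil.
  by rewrite big_cons /= IH.
rewrite /graphs big_enum; apply: eq_bigl => E.
by rewrite powersetE.
Qed.

Lemma INR_expn a b : INR (a ^ b)%N = INR a ^ b.
Proof. by elim: b => // b IH; rewrite expnS mult_INR IH. Qed.

Lemma exp_INR_mul x k : exp (INR k * x) = exp x ^ k.
Proof.
elim: k => [|k IH]; first by rewrite Rmult_0_l exp_0.
by rewrite S_INR Rmult_plus_distr_r Rmult_1_l exp_plus IH /=; ring.
Qed.

Lemma le_INR_leq a b : (a <= b)%N -> INR a <= INR b.
Proof. by move=> /leP; exact: le_INR. Qed.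

Lemma ln_le x y : 0 < x -> x <= y -> ln x <= ln y.
Proof.
by move=> x0 [lt|->]; [exact/Rlt_le/ln_increasing | exact: Rle_refl].
Qed.

(* With [lg = ln n] and [la = ln (1/p)]: the [n^(14 W)] sparse patterns with [s]
   entries are outweighed by the probability [p^((s-m)/2)] that one of them
   appears. *)
Lemma pattern_exponent lg la k m s W :
  0 < la -> la <= lg -> 0 <= k -> 1 <= m -> 0 <= s ->
  W * m <= s * k -> 100 * k * lg <= m * la -> m * m <= s * k ->
  14 * W * lg - la * ((s - m) / 2) <= - (24 * lg).
Proof.
move=> la0 lalg k0 m1 s0 Wm klg mm.
have lg0 : 0 < lg by lra.
have m0 : 0 < m by lra.
have skl : 100 * (s * k * lg) <= s * (m * la).
  have := Rmult_le_compat_l s _ _ s0 klg; lra.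
(* Everything is measured against [s * la]: each of [W * lg], [m * lg], [m * la] and [lg] is at most
   a hundredth of it, and 14/100 + 1/200 + 24/100 < 1/2. *)
have W1 : 100 * (W * lg) <= s * la.
  apply: (Rmult_le_reg_r m) => //.
  have := Rmult_le_compat_r lg _ _ (Rlt_le _ _ lg0) Wm; nra.
have m2 : 100 * (m * lg) <= s * la.
  apply: (Rmult_le_reg_r m) => //.
  have := Rmult_le_compat_r lg _ _ (Rlt_le _ _ lg0) mm; nra.
have mla : m * la <= m * lg by apply: Rmult_le_compat_l; lra.
have mlg : lg <= m * lg by nra.
lra.
Qed.

Section LowerTail.
Variables (F : fieldType) (n : nat) (p : R).
Hypotheses (n3 : (3 <= n)%N) (p_gt0 : 0 < p) (p_lt1 : p < 1) (np : / INR n <= p).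

Local Notation lg := (ln (INR n)).
Local Notation la := (ln (/ p)).

(** What [sparse_skeleton] extracts from a fitting matrix of rank below the threshold, with the
    parameters fixed for counting. *)
Definition bad_pattern (k m s : nat) (S : {set 'I_n * 'I_n}) : Prop :=
  [/\ #|S| = s, #|[set i | (i, i) \in S]| = m, (0 < m)%N, (m * m <= s * k)%N &
      100 * INR k * lg <= INR m * la] /\
  exists (f g : {ffun 'I_k -> 'I_n})
    (L : {ffun 'I_(2 * (s * k %/ m)) -> 'I_n * 'I_n}) u,
    S = supp (@skeleton F n _ _ f g L u).

Definition bad_patterns k m s : {set {set 'I_n * 'I_n}} :=
  [set S | if excluded_middle_informative (bad_pattern k m s S) then true else false].

Lemma bad_patternsP k m s S : S \in bad_patterns k m s -> bad_pattern k m s S.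
Proof. by rewrite inE; case: excluded_middle_informative. Qed.

Lemma n_gt0 : 0 < INR n.
Proof. by apply: lt_0_INR; apply/ltP; exact: leq_trans n3. Qed.

Lemma la_gt0 : 0 < la.
Proof.
rewrite -ln_1; apply: ln_increasing; first lra.
by rewrite -Rinv_1; apply: Rinv_lt_contravar; lra.
Qed.

Lemma la_le_lg : la <= lg.
Proof.
have n0 := n_gt0; apply: ln_le; first exact: Rinv_0_lt_compat.
rewrite -[X in _ <= X]Rinv_inv; apply: Rinv_le_contravar => //.
exact: Rinv_0_lt_compat.
Qed.

Lemma bad_patterns_weight k m s : (k <= n)%N ->
  \big[Rplus/0]_(S in bad_patterns k m s) (p ^ #|edges_of S|) <= exp (- (24 * lg)).
Proof.
move=> kn.
have [S0 S0P|P0] := pickP (mem (bad_patterns k m s)); last first.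
  rewrite big1 => [|S SP]; first exact: Rlt_le (exp_pos _).
  by have := P0 S; rewrite /= SP.
have [[cs cm m0 mm klg] _] := bad_patternsP S0P.
set W := (s * k %/ m)%N.
have ms : (m <= s)%N.
  rewrite -cs -cm -(card_imset [set i | (i, i) \in S0] (f := fun i => (i, i))).
    by apply/subset_leq_card/subsetP => x /imsetP[i]; rewrite inE => iS ->.
  by move=> i j [].
have kW : (k <= W)%N by rewrite leq_divRL // mulnC leq_mul2r ms orbT.
(* The exponent 14 is 2 + 4 + 8: the bases cost [2 * k <= 2 * W], the [2 * W] positions [4 * W], and
   the zero-pattern count [8 * W], its base being at most [n ^ 4]. *)
have cardP : INR #|bad_patterns k m s| <= exp (14 * INR W * lg).
  apply: (@Rle_trans _ (INR (n ^ (14 * W)))); last first.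
    rewrite INR_expn -{1}(exp_ln (INR n)); last exact: n_gt0.
    rewrite -exp_INR_mul mult_INR; apply: Req_le; congr exp.
    by rewrite (_ : INR 14 = 14) /=; ring.
  apply: le_INR_leq; apply: leq_trans (@card_skeleton_patterns F n k (2 * W) _ _) _.
    by move=> S /bad_patternsP[].
  have base : ((n * n * (k + 2)).+1 <= n ^ 4)%N.
    apply: (@leq_trans ((n * n * (n + 2)).+1)); first by rewrite ltnS leq_mul2l leq_add2r kn orbT.
    have -> : (n ^ 4 = n * n * (n * n))%N by rewrite !expnS expn0 muln1 !mulnA.
    have nn : (n + 2 < n * n)%N by nia.
    apply: (@leq_trans (n * n * (n + 2).+1)); last by rewrite leq_mul2l nn orbT.
    by rewrite mulnS -add1n leq_add2r; nia.
  apply: (@leq_trans (n ^ k * n ^ k * (n ^ 2) ^ (2 * W) * (n ^ 4) ^ (2 * W))).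
    rewrite -(mulnn n) leq_mul //; case: (2 * W)%N => // e.
    by rewrite leq_exp2r.
  rewrite -!expnM -!expnD leq_pexp2l //; last by lia.
  lia.
have weight S : S \in bad_patterns k m s ->
    p ^ #|edges_of S| <= exp (- (la * ((INR s - INR m) / 2))).
  move=> /bad_patternsP[[cs' cm' _ _ _] _].
  have pe : p = exp (- la) by rewrite ln_Rinv // Ropp_involutive exp_ln.
  rewrite [X in X ^ _]pe -exp_INR_mul.
  have := card_edges_of S; rewrite cs' cm' => /le_INR_leq.
  rewrite plus_INR mult_INR => H.
  have {}H : (INR s - INR m) / 2 <= INR #|edges_of S| by move: H => /=; lra.
  have [lt|<-] : INR #|edges_of S| * - la < - (la * ((INR s - INR m) / 2)) \/
      INR #|edges_of S| * - la = - (la * ((INR s - INR m) / 2)).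
  - by have := Rmult_le_compat_l la _ _ (Rlt_le _ _ la_gt0) H; lra.
  - exact/Rlt_le/exp_increasing.
  exact: Rle_refl.
apply: Rle_trans (Rsum_le _ weight) _.
rewrite Rsum_const.
apply: (@Rle_trans _ (exp (14 * INR W * lg) * exp (- (la * ((INR s - INR m) / 2))))).
  by apply: Rmult_le_compat_r cardP; exact: Rlt_le (exp_pos _).
rewrite -exp_plus.
have : 14 * INR W * lg - la * ((INR s - INR m) / 2) <= - (24 * lg).
  apply: (@pattern_exponent _ _ (INR k)) => //.
  - exact: la_gt0.
  - exact: la_le_lg.
  - exact: pos_INR.
  - exact: (le_INR_leq m0).
  - exact: pos_INR.
  - by rewrite -!mult_INR; apply: le_INR_leq; exact: leq_trunc_div.
  - by rewrite -!mult_INR; apply: le_INR_leq.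
case=> [lt|eq]; first by apply/Rlt_le/exp_increasing; lra.
by apply: Req_le; congr exp; rewrite -eq; ring.
Qed.

Lemma lower_tail :
  gnp_prob p (fun E : {set 'I_n * 'I_n} =>
    INR (minrank F E) < / 100 * (INR n * la / lg)) <= / INR n.
Proof.
pose Q := ('I_n.+1 * 'I_n.+1 * 'I_(n * n).+1)%type.
have lg0 : 0 < lg by apply: Rlt_le_trans la_gt0 la_le_lg.
have n0 := n_gt0.
rewrite gnp_probE.
(* Union bound: the event is dominated by the number of bad patterns whose edges all lie in [E]. *)
apply: (@Rle_trans _ (Ex p (upairs n) (fun E =>
    \big[Rplus/0]_(q : Q) \big[Rplus/0]_(S in bad_patterns q.1.1 q.1.2 q.2)
      (if edges_of S \subset E then 1 else 0)))).
  apply: Ex_le; [lra|lra|move=> E EU].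
  have sum0 (q : Q) : 0 <= \big[Rplus/0]_(S in bad_patterns q.1.1 q.1.2 q.2)
      (if edges_of S \subset E then 1 else 0).
    apply: big_ind => [|x y x0 y0|S _]; [lra | lra | by case: ifP => _; lra].
  case: excluded_middle_informative => [small|nsmall] /=; last first.
    by apply: big_ind => //; [lra | move=> x y x0 y0; lra].
  have [M fM rM] := minrank_fits F E.
  have [|S] := @sparse_skeleton F n M _ (fun i => fM.1 i); first exact: leq_trans n3.
  set m := #|[set i | (i, i) \in S]|; move=> [k [SM m0 kn mm sk]].
  have mn : (m <= n)%N by rewrite -[X in (_ <= X)%N](card_ord n) max_card.
  have sn : (#|S| <= n * n)%N by have := max_card (mem S); rewrite card_prod card_ord.
  have kn' : (k <= n)%N.
    rewrite -(leq_pmul2r (ltn_trans (isT : 0 < 2)%N n3)); apply: leq_trans kn _.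
    by rewrite leq_mul // rank_leq_row.
  (* The ratio of [k] to [m] is at most that of [\rank M] to [n], so the submatrix inherits the
     small rank. *)
  have klg : 100 * INR k * lg <= INR m * la.
    have rlt : INR (\rank M) * 100 * lg <= INR n * la.
      apply: (@Rle_trans _ (100 * lg * (/ 100 * (INR n * la / lg)))).
        rewrite Rmult_assoc Rmult_comm; apply: Rmult_le_compat_l; first by lra.
        by apply: Rle_trans (le_INR_leq rM) (Rlt_le _ _ small).
      by apply: Req_le; field; lra.
    have := le_INR_leq kn; rewrite !mult_INR => knR.
    apply: (Rmult_le_reg_r (INR n)) => //.
    have H1 := Rmult_le_compat_l (100 * lg) _ _ ltac:(lra) knR.
    have H2 := Rmult_le_compat_l (INR m) _ _ (pos_INR m) rlt.
    lra.
  rewrite (bigD1 ((inord k, inord m), inord #|S|)) //= !inordK ?ltnS //.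
  rewrite (bigD1 S) /=; last first.
    rewrite inE; case: excluded_middle_informative => // -[].
    by split; [split | exact: sk].
  rewrite (edges_of_fits EU fM SM).
  set x := \big[Rplus/0]_(_ | _) _; set y := \big[Rplus/0]_(_ | _) _.
  have x0 : 0 <= x.
    apply: big_ind => [|a b a0 b0|S' _]; [lra | lra | by case: ifP => _; lra].
  have y0 : 0 <= y by apply: big_ind => //; [lra | move=> a b a0 b0; lra].
  lra.
rewrite Ex_sum; under eq_bigr => q _ do rewrite Ex_sum.
apply: (@Rle_trans _ (\big[Rplus/0]_(q : Q) exp (- (24 * lg)))).
  apply: Rsum_le => q _; under eq_bigr => S _.
    rewrite Ex_superset; last by apply/subsetP => x; rewrite inE => /andP[].
    over.
  by apply: bad_patterns_weight; rewrite -ltnS.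
rewrite Rsum_const !card_prod !card_ord.
have -> : exp (- (24 * lg)) = / INR n ^ 24.
  rewrite exp_Ropp; congr Rinv; rewrite -[in RHS](exp_ln (INR n)) // -exp_INR_mul.
  by congr (exp (_ * _)); rewrite /=; lra.
(* At most [n ^ 23] triples [(k, m, s)], each of weight at most [n ^ (-24)], leave [/ INR n]. *)
have cnt : INR (n.+1 * n.+1 * (n * n).+1) <= INR n ^ 23.
  rewrite -INR_expn; apply: le_INR_leq; apply: (@leq_trans (n ^ 8)).
    have -> : (n ^ 8 = (n * n) * (n * n) * (n * n * (n * n)))%N.
      by rewrite !expnS expn0 muln1 !mulnA.
    by apply: leq_mul; [apply: leq_mul; nia | nia].
  by rewrite leq_pexp2l //; lia.
apply: (Rmult_le_reg_r (INR n ^ 24)); first exact: pow_lt.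
rewrite Rmult_assoc Rinv_l ?Rmult_1_r; last by apply: pow_nonzero; lra.
rewrite (_ : INR n ^ 24 = INR n * INR n ^ 23) // -Rmult_assoc Rinv_l; last by lra.
by rewrite Rmult_1_l.
Qed.

End LowerTail.
End Tail.

(** * The upper bound *)

Section CliqueCover.
Import GRing.Theory.
Local Open Scope ring_scope.

(** The 0/1 matrix with ones exactly inside the classes of [c] fits the graph and factors through
    dimension [k]. *)
Lemma minrank_clique_cover (F : fieldType) n k (E : {set 'I_n * 'I_n})
    (c : 'I_n -> 'I_k) :
  (forall i j, i != j -> c i = c j -> adj E i j) -> (minrank F E <= k)%N.
Proof.
move=> cE; pose P := \matrix_(i < n, a < k) (c i == a)%:R : 'M[F]_(n, k).
have PP i j : (P *m P^T) i j = (c i == c j)%:R.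
  rewrite mxE (bigD1 (c i)) //= !mxE eqxx mul1r big1 ?addr0 1?eq_sym // => a ai.
  by rewrite !mxE eq_sym (negbTE ai) mul0r.
apply: (@leq_trans (\rank (P *m P^T))); last first.
  exact: leq_trans (mxrankM_maxl _ _) (rank_leq_col _).
apply: minrank_le; split=> [i|i j ij nadj]; rewrite PP.
  by rewrite eqxx oner_neq0.
by case: eqP => // /(cE i j ij); rewrite (negbTE nadj).
Qed.

End CliqueCover.

(** * Greedy clique covers *)

Section GreedyCover.
Local Open Scope R_scope.
Variables (n k l h : nat) (p : R).
Hypotheses (p0 : 0 <= p) (p1 : p <= 1).
Hypotheses (h0 : (0 < h)%N) (hk : (2 * h <= k)%N) (nlh : (n < l * h)%N).
Implicit Types (E : {set 'I_n * 'I_n}) (c : {ffun 'I_n -> 'I_k}).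

(** The colouring [c] is total, but only the vertices below [v] count as already inserted. *)
Definition cluster v c (a : 'I_k) : {set 'I_n} := [set i : 'I_n | (i < v)%N && (c i == a)].

Definition cliques v c E : bool :=
  [forall i : 'I_n, forall j : 'I_n, (i < j < v)%N && (c i == c j) ==> ((i, j) \in E)].

Definition coverable v E : bool :=
  [exists c, cliques v c E && [forall a, (#|cluster v c a| <= l)%N]].

Definition pairs_below v : {set 'I_n * 'I_n} := [set x in upairs n | (x.2 < v)%N].

(** The fresh randomness exposed when [v] is inserted. *)
Definition star v : {set 'I_n * 'I_n} := [set x in upairs n | x.2 == v].

Lemma pairs_belowS (v : 'I_n) : pairs_below v.+1 = pairs_below v :|: star v.
Proof.
by apply/setP => x; rewrite !inE -andb_orr ltnS [in LHS](leq_eqVlt x.2) [in LHS](orbC (_ == _)).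
Qed.

Lemma pairs_below_star (v : 'I_n) : [disjoint pairs_below v & star v].
Proof.
rewrite -setI_eq0; apply/eqP/setP => x; rewrite !inE.
by case: eqP => [->|]; rewrite ?ltnn !andbF.
Qed.

(** Full clusters hold at least [l] vertices each and [n < l * h], so fewer than [h] of the
    [k >= 2 * h] clusters are full. *)
Lemma card_free v c :
  (h <= #|[set a | (#|cluster v c a| < l)%N]|)%N.
Proof.
set free := [set a | _].
have : (l * #|~: free| <= n)%N.
  apply: (@leq_trans (\sum_(a in ~: free) #|cluster v c a|)).
    rewrite mulnC -sum_nat_const; apply: leq_sum => a.
    by rewrite !inE -leqNgt.
  apply: (@leq_trans (\sum_a #|cluster v c a|)).
    by rewrite [leqLHS]big_mkcond; apply: leq_sum => a _; case: ifP.
  have -> : (\sum_a #|cluster v c a| = #|[set i : 'I_n | (i < v)%N]|)%N.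
    rewrite -[RHS]sum1_card (partition_big c predT) //; apply: eq_bigr => a _.
    by rewrite -sum1_card; apply: eq_bigl => i; rewrite !inE.
  by rewrite -[X in (_ <= X)%N](card_ord n) max_card.
have := cardsC free; rewrite card_ord => eqk le.
have : (l * #|~: free| < l * h)%N by apply: leq_ltn_trans le nlh.
rewrite ltn_mul2l => /andP[_]; lia.
Qed.

Lemma coverable_step (v : 'I_n) c (a : 'I_k) E E' :
  cliques v c E -> (forall b, (#|cluster v c b| <= l)%N) ->
  (#|cluster v c a| < l)%N -> [set (i, v) | i in cluster v c a] \subset E' ->
  coverable v.+1 (E :|: E').
Proof.
move=> /forallP cE cl cla /subsetP sub.
pose c' := [ffun i => if i == v then a else c i].
have c'v (i : 'I_n) : (i < v)%N -> c' i = c i.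
  by move=> iv; rewrite ffunE; case: eqP iv => // ->; rewrite ltnn.
have c'a : c' v = a by rewrite ffunE eqxx.
apply/existsP; exists c'; apply/andP; split.
  apply/forallP => i; apply/forallP => j; apply/implyP => /andP[/andP[ij]].
  rewrite ltnS leq_eqVlt inE => /predU1P[/val_inj jv|jv] /eqP.
    rewrite jv in ij *; rewrite c'a (c'v _ ij) => ca.
    by apply/orP; right; apply: sub; rewrite imset_f // inE ij ca eqxx.
  rewrite (c'v _ jv) (c'v _ (ltn_trans ij jv)) => cij.
  by have /forallP/(_ j)/implyP->// := cE i; rewrite ij jv cij eqxx.
apply/forallP => b.
have [ba|ba] := eqVneq b a.
  apply: leq_trans cla; rewrite ba.
  have -> : cluster v.+1 c' a = v |: cluster v c a.
    apply/setP => i; rewrite !inE ltnS leq_eqVlt.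
    have [->|iv] := eqVneq i v; first by rewrite eqxx c'a eqxx.
    have nv : (i == v :> nat) = false by exact: negbTE iv.
    by rewrite nv ffunE (negbTE iv).
  by rewrite cardsU1 inE ltnn.
apply: leq_trans (cl b); apply/subset_leq_card/subsetP => i; rewrite !inE ltnS leq_eqVlt.
case/andP => /predU1P[/val_inj ->|iv]; first by rewrite c'a eq_sym (negbTE ba).
by rewrite c'v // iv.
Qed.

Local Notation ind b := (if b then 1 else 0).

(** Each insertion fails with probability at most [(1 - p ^ l) ^ h] given the earlier edges, and
    failures add up over the vertices. *)
Lemma coverable_prob v : (v <= n)%N ->
  1 - INR v * (1 - p ^ l) ^ h <= Ex p (pairs_below v) (fun E => ind (coverable v E)).
Proof.
have pl0 : 0 <= p ^ l by exact: pow_le.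
have pl1 : p ^ l <= 1 by rewrite -(pow1 l); apply: pow_incr.
have eps0 : 0 <= (1 - p ^ l) ^ h by apply: pow_le; lra.
elim: v => [_|v IH vn].
  rewrite (@eq_Ex _ p _ _ (fun=> 1)) ?Ex_const => [|E _]; first by rewrite /=; lra.
  have k0 : (0 < k)%N by apply: leq_trans hk; rewrite muln_gt0.
  rewrite (_ : coverable 0 E) //; apply/existsP; exists [ffun=> Ordinal k0].
  apply/andP; split.
    by apply/forallP => i; apply/forallP => j; rewrite ltn0 andbF.
  apply/forallP => a; have -> : cluster 0 [ffun=> Ordinal k0] a = set0.
    by apply/setP => i; rewrite !inE.
  by rewrite cards0.
have {}IH := IH (ltnW vn); pose w := Ordinal vn.
rewrite (pairs_belowS w) ExU; last exact: pairs_below_star.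
apply: (@Rle_trans _ (Ex p (pairs_below v)
    (fun E => ind (coverable v E) + - (1 - p ^ l) ^ h))).
  by rewrite ExD Ex_const S_INR; lra.
(* Fix the edges below [v]. If they are not coverable, the left side is at most 0; otherwise fix a
   cover [c] and expose only the star of [v]. *)
apply: Ex_le => // E _.
case: ifP => [/existsP[c /andP[cE /forallP cl]]|_]; last first.
  apply: (@Rle_trans _ 0); first by lra.
  by rewrite -{1}(Ex_const p (star w) 0); apply: Ex_le => // E' _; case: ifP => _; lra.
pose free := [set a | (#|cluster v c a| < l)%N].
(* The vertex joins a free cluster once all edges to it are present; these edge sets are disjoint,
   have size at most [l], and number at least [h]. *)
pose s := [seq [set (i, w) | i in cluster v c a] | a <- enum free].
apply: (@Rle_trans _ (Ex p (star w) (fun E' =>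
    1 + (-1) * if has (fun S : {set 'I_n * 'I_n} => S \subset E') s then 0 else 1))).
  have av : Ex p (star w) (fun E' =>
      if has (fun S : {set 'I_n * 'I_n} => S \subset E') s then 0 else 1)
      <= (1 - p ^ l) ^ size s.
    apply: Ex_avoid => // [|S /mapP[a]].
      rewrite pairwise_map; have : uniq (enum free) by exact: enum_uniq.
      rewrite uniq_pairwise; apply: sub_pairwise => a b ab.
      rewrite /= -setI_eq0; apply/eqP/setP => x; rewrite !inE.
      apply/negP => /andP[/imsetP[i] + ->] /imsetP[j + [ij]].
      rewrite -ij !inE => /andP[_ /eqP ca] /andP[_ /eqP cb].
      by rewrite /= -ca -cb eqxx in ab.
    move=> _ ->; split; last exact: leq_trans (leq_imset_card _ _) (cl a).
    apply/subsetP => x /imsetP[i]; rewrite inE => /andP[iv _] ->.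
    by rewrite !inE /= iv eqxx.
  rewrite ExD Ex_const Ex_scale.
  have : (1 - p ^ l) ^ size s <= (1 - p ^ l) ^ h.
    rewrite size_map -cardE -(subnKC (card_free v c)) pow_add -[X in _ <= X]Rmult_1_r.
    apply: Rmult_le_compat_l => //; rewrite -[X in _ <= X](pow1 (#|free| - h)).
    by apply: pow_incr; lra.
  lra.
apply: Ex_le => // E' _; case: hasP => [[S /mapP[a]]|_]; last by case: ifP => _; lra.
rewrite mem_enum inE => la -> sub.
rewrite (@coverable_step w c a) //; lra.
Qed.

Lemma clique_cover_tail (F : fieldType) :
  gnp_prob p (fun E : {set 'I_n * 'I_n} => ~ (minrank F E <= k)%N)
    <= INR n * (1 - p ^ l) ^ h.
Proof.
rewrite gnp_probE.
have := coverable_prob (leqnn n).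
have -> : pairs_below n = upairs n.
  by apply/setP => x; rewrite !inE ltn_ord andbT.
move=> H.
apply: (@Rle_trans _ (Ex p (upairs n) (fun E => 1 + (-1) * ind (coverable n E)))).
  apply: Ex_le => // E EU.
  case: excluded_middle_informative => big /=; last by case: ifP => _; lra.
  case: ifP => [/existsP[c /andP[/forallP cE _]]|_]; last by lra.
  case: big; apply: (@minrank_clique_cover F n k E c) => i j ij cij.
  have cE' (i' j' : 'I_n) : (i' < j')%N -> c i' = c j' -> (i', j') \in E.
    move=> lt e; have /forallP/(_ j')/implyP := cE i'; apply.
    by rewrite lt ltn_ord e eqxx.
  rewrite /adj; have [lt|lt|/val_inj e] := ltngtP i j.
  - by rewrite cE'.
  - by rewrite (cE' j i) ?orbT.
  - by rewrite e eqxx in ij.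
by rewrite ExD Ex_const Ex_scale; lra.
Qed.

End GreedyCover.

(** * Choice of the clique size and estimates *)

Section UpperTail.
Local Open Scope R_scope.

Lemma nat_floor x : 0 <= x -> exists m : nat, INR m <= x < INR m + 1.
Proof.
move=> x0; have [H1 H2] := archimed x.
have up0 : Z.lt Z0 (up x) by apply: lt_IZR; lra.
have : Z.le Z0 (Z.sub (up x) (Zpos xH)) by lia.
move=> /IZN[m em]; exists m; rewrite INR_IZR_INZ -em minus_IZR; lra.
Qed.

(** Cubic growth is enough to make a small power of [n] exceed the square of [ln n]. *)
Lemma exp_cube y : 0 <= y -> (y / 3) ^ 3 <= exp y.
Proof.
move=> y0; rewrite {2}(_ : y = INR 3 * (y / 3)); last by rewrite /=; field.
rewrite exp_INR_mul; apply: pow_incr; have := exp_ineq1_le (y / 3); lra.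
Qed.

Lemma upper_tail (F : fieldType) n p :
  0 < p -> p < 1 -> 100000 <= ln (INR n) -> p <= 1 - Rpower (INR n) (- 0.99) ->
  gnp_prob p (fun E : {set 'I_n * 'I_n} =>
    ~ (INR (minrank F E) <= 5000 * (INR n * ln (/ p) / ln (INR n)))) <= / INR n.
Proof.
move=> p0 p1; set lg := ln (INR n) => lgL pn.
have n0 : 0 < INR n.
  case: n @lg lgL {pn} => [|m] lg lgL; last by apply: lt_0_INR; apply/ltP.
  exfalso; move: lgL; rewrite /lg /ln; case: Rlt_dec => [/=|] *; lra.
have ne : INR n = exp lg by rewrite /lg exp_ln.
(* The upper bound on [p] enters here, through [ln (/ p) >= 1 - p]. *)
have la1 : exp (- 0.99 * lg) <= ln (/ p).
  apply: (@Rle_trans _ (1 - p)); first by move: pn; rewrite /Rpower -/lg; lra.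
  rewrite ln_Rinv //.
  have := exp_ineq1_le (ln p); rewrite exp_ln //; lra.
set la := ln (/ p) in la1 *.
have la0 : 0 < la by apply: Rlt_le_trans la1; exact: exp_pos.
have invn0 : 0 < / INR n by exact: Rinv_0_lt_compat.
have mono k : INR k <= 5000 * (INR n * la / lg) ->
    gnp_prob p (fun E : {set 'I_n * 'I_n} =>
      ~ (INR (minrank F E) <= 5000 * (INR n * la / lg)))
    <= gnp_prob p (fun E : {set 'I_n * 'I_n} => ~ (minrank F E <= k)%N).
  move=> kC; rewrite !gnp_probE; apply: Ex_le; [lra|lra|move=> E _].
  case: excluded_middle_informative => [H|_] /=; case: excluded_middle_informative => H' /=;
    try lra.
  exfalso; apply: H' => /le_INR_leq mk; apply: H; exact: Rle_trans mk kC.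
have lg0 : 0 < lg by lra.
(* If [p] is at most [n ^ (-0.001)], the claimed bound exceeds [n] and the trivial bound applies. *)
have [big|small] := Rle_lt_dec (0.001 * lg) la.
  have nC : INR n <= 5000 * (INR n * la / lg).
    have -> : 5000 * (INR n * la / lg) = INR n * (5000 * la / lg) by field; lra.
    rewrite -{1}(Rmult_1_r (INR n)); apply: Rmult_le_compat_l; first lra.
    apply: (Rmult_le_reg_r lg) => //.
    by rewrite /Rdiv Rmult_assoc Rinv_l; lra.
  apply: Rle_trans (mono n nC) _; rewrite gnp_probE.
  rewrite (@eq_Ex _ p _ _ (fun=> 0)) ?Ex_const; first lra.
  move=> E _; case: excluded_middle_informative => // H; case: H; exact: minrank_leq_size.
have x1 : 1 < 0.001 * lg / la.
  by apply: (Rmult_lt_reg_r la) => //; rewrite /Rdiv Rmult_assoc Rinv_l; lra.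
(* This [l] keeps [p ^ l] at least [n ^ (-0.001)]; as the real number exceeds 1, rounding down loses
   at most a factor 2. *)
have [l [lx xl]] := nat_floor (Rlt_le _ _ (Rlt_trans _ _ _ Rlt_0_1 x1)).
have l0 : (0 < l)%N by case: l lx xl => // lx; rewrite /=; lra.
have l1 : 1 <= INR l by exact: (le_INR_leq l0).
have lla : INR l * la <= 0.001 * lg.
  apply: (Rmult_le_reg_r (/ la)); first exact: Rinv_0_lt_compat.
  by rewrite (Rmult_assoc _ la) Rinv_r; lra.
have llb : 0.001 * lg <= 2 * INR l * la.
  apply: (Rmult_le_reg_r (/ la)); first exact: Rinv_0_lt_compat.
  by rewrite (Rmult_assoc _ la) Rinv_r; lra.
pose h := (n %/ l).+1.
have nlh : (n < l * h)%N by rewrite mulnC ltn_ceil.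
set x := exp (0.009 * lg).
(* This fixes the threshold 100000 for [lg]: the cube of [0.003 * lg] times 1000 is then at least
   [2.7 * lg * lg]. *)
have xbig : 2 * lg * lg <= 1000 * x.
  have := @exp_cube (0.009 * lg); rewrite -/x => /(_ ltac:(lra)).
  have -> : (0.009 * lg / 3) ^ 3 = 27 / 1000000000 * (lg * lg * lg).
    by rewrite (_ : 0.009 = 9 / 1000); [field | lra].
  have : lg * lg * 100000 <= lg * lg * lg by apply: Rmult_le_compat_l; nra.
  have := Rle_0_sqr lg; rewrite /Rsqr; lra.
have nla : x * exp (0.001 * lg) <= INR n * la.
  rewrite -exp_plus (_ : _ + _ = lg + - 0.99 * lg); last by lra.
  by rewrite exp_plus -ne; apply: Rmult_le_compat_l; lra.
have e1 : 1 <= exp (0.001 * lg) by have := exp_ineq1_le (0.001 * lg); lra.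
have x0 : 0 < x by exact: exp_pos.
set y := INR n * la / lg.
have ylg : y * lg = INR n * la by rewrite /y; field; lra.
have y1 : 1 <= y.
  apply: (Rmult_le_reg_r lg) => //; rewrite ylg.
  apply: Rle_trans nla; nra.
have nl : INR (n %/ l) * INR l <= INR n.
  by rewrite -mult_INR; apply: le_INR_leq; exact: leq_trunc_div.
have hS : INR h = INR (n %/ l) + 1 by rewrite S_INR.
(* [n / l] is at most [2000 * y], so [2 * h] is at most [4000 * y + 2], and [y >= 1] absorbs the
   2. *)
have hk : INR (2 * h) <= 5000 * y.
  rewrite mult_INR hS (_ : INR 2 = 2) //.
  suff : INR (n %/ l) <= 2000 * y by lra.
  apply: (Rmult_le_reg_r (0.001 * lg)); first lra.
  apply: (@Rle_trans _ (INR (n %/ l) * (2 * INR l * la))).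
    by apply: Rmult_le_compat_l llb; exact: pos_INR.
  have := Rmult_le_compat_r la _ _ (Rlt_le _ _ la0) nl; lra.
apply: Rle_trans (mono _ hk) _.
apply: Rle_trans (@clique_cover_tail n (2 * h) l h p _ _ _ _ _ F) _ => //; try lra.
have pl : exp (- (0.001 * lg)) <= p ^ l.
  rewrite -{1}(exp_ln p) // -exp_INR_mul.
  have -> : ln p = - la by rewrite /la ln_Rinv //; ring.
  have [lt|eq] : INR l * la < 0.001 * lg \/ INR l * la = 0.001 * lg by lra.
  - apply/Rlt_le/exp_increasing; lra.
  - by apply: Req_le; congr exp; lra.
(* The expected number of available cliques is at least [1000 * y * n ^ (-0.001)], hence at least
   [1000 * x / lg], which [xbig] compares with [2 * lg]. *)
have hpl : 2 * lg <= INR h * p ^ l.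
  have hy : 1000 * y <= INR h.
    apply: (Rmult_le_reg_r (0.001 * lg)); first lra.
    apply: (@Rle_trans _ (INR n * la)); first by lra.
    apply: (@Rle_trans _ (INR h * (INR l * la))); last first.
      by apply: Rmult_le_compat_l lla; exact: pos_INR.
    rewrite -Rmult_assoc; apply: Rmult_le_compat_r; first lra.
    by rewrite Rmult_comm -mult_INR; apply: le_INR_leq; exact: ltnW.
  apply: (@Rle_trans _ (1000 * y * exp (- (0.001 * lg)))); last first.
    apply: Rmult_le_compat => //; [lra | exact: Rlt_le (exp_pos _)].
  apply: (Rmult_le_reg_r (lg * exp (0.001 * lg))); first by nra.
  rewrite exp_Ropp.
  have -> : 1000 * y * / exp (0.001 * lg) * (lg * exp (0.001 * lg)) = 1000 * (y * lg).
    by field; lra.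
  rewrite ylg; apply: (@Rle_trans _ (1000 * (x * exp (0.001 * lg)))); last lra.
  rewrite -!Rmult_assoc; apply: Rmult_le_compat_r; lra.
have eps : (1 - p ^ l) ^ h <= exp (- (2 * lg)).
  apply: (@Rle_trans _ (exp (- p ^ l) ^ h)).
    apply: pow_incr; split.
      have : p ^ l <= 1 by rewrite -(pow1 l); apply: pow_incr; lra.
      lra.
    have := exp_ineq1_le (- p ^ l); lra.
  rewrite -exp_INR_mul.
  have [lt|eq] : 2 * lg < INR h * p ^ l \/ 2 * lg = INR h * p ^ l by lra.
  - apply/Rlt_le/exp_increasing; lra.
  - by apply: Req_le; congr exp; lra.
apply: (@Rle_trans _ (INR n * exp (- (2 * lg)))).
  by apply: Rmult_le_compat_l => //; lra.
rewrite ne -exp_plus -exp_Ropp; apply: Req_le; congr exp; ring.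
Qed.

(** * Combination of the two tails *)

Lemma ln_INR_unbounded K : exists N : nat, forall n, (N <= n)%N -> K <= ln (INR n).
Proof.
have [N NK] := INR_unbounded (exp K).
exists N => n /le_INR_leq Nn; rewrite -(ln_exp K).
by apply: ln_le; [exact: exp_pos | lra].
Qed.

Lemma gnp_prob_le1 n p (Q : {set 'I_n * 'I_n} -> Prop) :
  0 <= p -> p <= 1 -> gnp_prob p Q <= 1.
Proof.
move=> p0 p1; rewrite gnp_probE -[X in _ <= X](Ex_const p (upairs n)).
by apply: Ex_le => // E _; case: excluded_middle_informative => H /=; lra.
Qed.

Lemma gnp_prob_and n p (P Q : {set 'I_n * 'I_n} -> Prop) :
  0 <= p -> p <= 1 ->
  1 - gnp_prob p (fun E => ~ P E) - gnp_prob p (fun E => ~ Q E)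
    <= gnp_prob p (fun E => P E /\ Q E).
Proof.
move=> p0 p1; rewrite !gnp_probE.
have <- : Ex p (upairs n) (fun E => 1
    + (-1) * (if excluded_middle_informative (~ P E) then 1 else 0)
    + (-1) * (if excluded_middle_informative (~ Q E) then 1 else 0))
  = 1 - Ex p (upairs n) (fun E => if excluded_middle_informative (~ P E) then 1 else 0)
      - Ex p (upairs n) (fun E => if excluded_middle_informative (~ Q E) then 1 else 0).
  by rewrite 2!ExD Ex_const !Ex_scale; ring.
apply: Ex_le => // E _.
case: (excluded_middle_informative (~ P E)) => HP /=;
  case: (excluded_middle_informative (~ Q E)) => HQ /=;
  case: (excluded_middle_informative (P E /\ Q E)) => HPQ /=; try lra.
by exfalso; tauto.
Qed.

End UpperTail.

Theorem theorem1p2 :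
  exists c C : R, (0 < c)%R /\ (c < C)%R /\
  forall (F : nat -> fieldType) (p : nat -> R),
    (exists N0 : nat, forall n : nat, (N0 <= n)%N ->
       (/ INR n <= p n)%R /\ (p n <= 1 - Rpower (INR n) (- 0.99))%R) ->
    Un_cv (fun n : nat =>
       @gnp_prob n (p n) (fun E =>
         (c * (INR n * ln (/ p n) / ln (INR n)) <= INR (minrank (F n) E))%R /\
         (INR (minrank (F n) E) <= C * (INR n * ln (/ p n) / ln (INR n)))%R))
      1%R.
Proof.
exists (/ 100)%R, 5000%R; split; first lra; split; first lra.
move=> F p [N0 hp] eps eps0.
have [N1 hN1] := ln_INR_unbounded 100000.
have [N2 hN2] := INR_unbounded (2 / eps)%R.
(* The lower tail asks for 3, the range of [p] for [N0], the upper tail for [N1]; [N2] makes the two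
   error terms [/ INR n] sum to less than [eps]. *)
exists (maxn 3 (maxn N0 (maxn N1 N2))) => n /leP.
rewrite !geq_max => /and4P[n3 nN0 nN1 nN2].
have [np pn] := hp n nN0.
have n0 := n_gt0 n3.
have p0 : (0 < p n)%R by apply: Rlt_le_trans np; exact: Rinv_0_lt_compat.
have p1 : (p n < 1)%R by have := exp_pos (- 0.99 * ln (INR n)); move: pn; rewrite /Rpower; lra.
have n2 : (2 * / INR n < eps)%R.
  apply: (Rmult_lt_reg_r (INR n)) => //; rewrite Rmult_assoc Rinv_l; last lra.
  have := le_INR_leq nN2 => le2.
  have : (2 / eps * eps < INR n * eps)%R by apply: Rmult_lt_compat_r => //; lra.
  by rewrite /Rdiv Rmult_assoc Rinv_l; lra.
have lower := lower_tail (F n) n3 p0 p1 np.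
have upper := upper_tail (F n) p0 p1 (hN1 n nN1) pn.
set G := gnp_prob _ _.
have G1 : (G <= 1)%R by apply: gnp_prob_le1; lra.
have : (1 - / INR n - / INR n <= G)%R.
  apply: Rle_trans (gnp_prob_and _ _ (Rlt_le _ _ p0) (Rlt_le _ _ p1)).
  have eqlow : gnp_prob (p n) (fun E : {set 'I_n * 'I_n} =>
      ~ (/ 100 * (INR n * ln (/ p n) / ln (INR n)) <= INR (minrank (F n) E))%R)
    = gnp_prob (p n) (fun E : {set 'I_n * 'I_n} =>
      (INR (minrank (F n) E) < / 100 * (INR n * ln (/ p n) / ln (INR n)))%R).
    rewrite !gnp_probE; apply: eq_Ex => E _.
    case: excluded_middle_informative => H; case: excluded_middle_informative => H' //=; lra.
  rewrite eqlow; lra.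
rewrite /R_dist => G2; apply: Rle_lt_trans n2.
by rewrite Rabs_left1; lra.
Qed.
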